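(* Let $n \geq 40$ and let $\mathcal{L} \subset \mathbb{R}^n$ be a lattice. Consider the following algorithm for GDD with preprocessing. The preprocessing consists of $N$ lattice vectors $\vec{y}_1,\dots,\vec{y}_N \in \mathcal{L}$. On input a target $\vec{t}\in\mathbb{R}^n$, the query algorithm first uses Babai's polynomial-time algorithm to find $\vec{t}_0 \in \mathcal{L} + \vec{t}$ with $\|\vec{t}_0\| \leq 2^n\eta(\mathcal{L})$ and sets $j=0$. It then repeatedly searches for an index $i\in\{1,\dots,N\}$ and an integer $k$ such that $\|\vec{t}_j - k\vec{y}_i\|^2 \leq (1-1/n^2)\|\vec{t}_j\|^2$; if found, it sets $\vec{t}_{j+1} := \vec{t}_j - k\vec{y}_i$ and increments $j$. Once it fails to find such $i,k$ (or once $j$ reaches $100n^3$), it outputs $\vec{t}_j - \vec{t} \in \mathcal{L}$. Then for every $\alpha$ with $\frac{2}{\log n} \leq \alpha \leq \frac12$, when the preprocessing consists of $N_\alpha := n^2 e^{(n^{1/2-\alpha}+4)^2} = 2^{O(n^{1-2\alpha}+\log n)}$ independent samples from $D_{\mathcal{L},s}$ with $s := \eta(\mathcal{L})$, this algorithm yields a solution to $d$-GDDP in time $\mathrm{poly}(n)\cdot N_\alpha$ with high probability (over the choice of the preprocessing), where $d := n^{1/2+\alpha}\cdot\eta(\mathcal{L})$.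
   Context: A lattice $\mathcal{L} \subset \mathbb{R}^n$ is the set of all integer linear combinations of $n$ linearly independent vectors in $\mathbb{R}^n$. For $s>0$ and $\vec{x}\in\mathbb{R}^n$ let $\rho_s(\vec{x}) := \exp(-\pi\|\vec{x}\|^2/s^2)$ and $\rho_s(A):=\sum_{\vec{a}\in A}\rho_s(\vec{a})$ for a discrete set $A$. The discrete Gaussian $D_{\mathcal{L},s}$ is the distribution on $\mathcal{L}$ with $\Pr[\vec{X}=\vec{y}] = \rho_s(\vec{y})/\rho_s(\mathcal{L})$ for $\vec{y}\in\mathcal{L}$. The dual lattice is $\mathcal{L}^* := \{\vec{w} : \langle\vec{w},\vec{y}\rangle\in\mathbb{Z}\ \forall \vec{y}\in\mathcal{L}\}$, and the smoothing parameter $\eta(\mathcal{L})$ is the unique $s>0$ with $\rho_{1/s}(\mathcal{L}^* ) = 3/2$. The logarithm $\log$ is base 2. ''Yields a solution to $d$-GDDP'' means: for every target $\vec{t}\in\mathbb{R}^n$ the output $\vec{y}\in\mathcal{L}$ satisfies $\|\vec{y}-\vec{t}\|\leq d$ (the high-probability event over the preprocessing is simultaneous for all targets). Running times are measured in terms of $n$, ignoring polynomial factors in input bit length.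
   Formalization: The algorithm's output is taken to be t − t_j rather than t_j − t (with the stated sign the distance to t would be ‖t_j − 2t‖, which is unbounded); the number of samples is N_α rounded up, and time counts unit-cost real operations. *)

(* Defs.v *)
From mathcomp Require Import all_boot all_order all_algebra.
From mathcomp Require Import all_classical all_reals all_analysis.

Set Implicit Arguments.
Unset Strict Implicit.
Unset Printing Implicit Defensive.

Import Order.TTheory GRing.Theory Num.Theory.
Local Open Scope classical_set_scope.
Local Open Scope ring_scope.

Section Euclidean.
Context {R : realType} {n : nat}.
Implicit Types (u v w x y : 'rV[R]_n) (L A : set 'rV[R]_n) (s eta : R).

(* The canonical norm of the library on ['rV[R]_n] is the sup norm, hence this
   separate Euclidean norm. *)
Definition dotp u v : R := \sum_(i < n) u 0 i * v 0 i.

Definition enorm u : R := Num.sqrt (dotp u u).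

(* The rows of [B] are the basis vectors; [row_free B] is their linear
   independence. *)
Definition lattice_of (B : 'M[R]_n) : set 'rV[R]_n :=
  [set y | exists z : 'rV[int]_n, y = map_mx intr z *m B].

Definition is_lattice L := exists2 B : 'M[R]_n, row_free B & L = lattice_of B.

Definition dual L : set 'rV[R]_n :=
  [set w | forall y, L y -> dotp w y \is a Num.int].

Definition rho s x : R := expR (- (pi * enorm x ^+ 2 / s ^+ 2)).

Definition rho_set s A : \bar R := (\esum_(a in A) (rho s a)%:E)%E.

Definition is_smoothing_parameter L eta :=
  0 < eta /\ rho_set eta^-1 (dual L) = (3 / 2)%:E.

Definition dgauss L s y : R := rho s y / fine (rho_set s L).

Definition gdd_solution L (dist : R) t y := L y /\ enorm (y - t) <= dist.

End Euclidean.

Section Sampling.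
Context {R : realType} {n : nat} {disp : measure_display}
  {T : measurableType disp}.
Variable P : probability T R.

(* [X] takes its values in the countable set [L], so its law is determined by
   the probabilities of the points of [L]. *)
Definition has_dgauss_law (X : T -> 'rV[R]_n) (L : set 'rV[R]_n) (s : R) :=
  (forall omega, L (X omega)) /\
  (forall y, L y -> measurable (X @^-1` [set y]) /\
                    P (X @^-1` [set y]) = (dgauss L s y)%:E).

(* Mutual independence. The product rule for proper subfamilies is the case
   where some of the [A i] are [setT]. *)
Definition mutually_independent N (Y : 'I_N -> T -> 'rV[R]_n) :=
  forall A : 'I_N -> set 'rV[R]_n,
    (forall i, measurable (Y i @^-1` A i)) ->
    P [set omega | forall i, A i (Y i omega)] =
      (\prod_(i < N) P (Y i @^-1` A i))%E.

Definition iid_dgauss N (Y : 'I_N -> T -> 'rV[R]_n) (L : set 'rV[R]_n)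
    (s : R) :=
  (forall i, has_dgauss_law (Y i) L s) /\ mutually_independent Y.

End Sampling.

Section TradeOff.
Context {R : realType}.
Implicit Types (n : nat) (alpha : R).

Definition log2 (x : R) : R := ln x / ln 2.

Definition Nalpha n alpha : R :=
  n%:R ^+ 2 * expR ((n%:R `^ (2^-1 - alpha) + 4) ^+ 2).

Definition nsamples n alpha : nat := `|Num.ceil (Nalpha n alpha)|%N.

Definition gdd_distance n alpha (eta : R) : R := n%:R `^ (2^-1 + alpha) * eta.

Definition shrink n : R := 1 - (n%:R ^+ 2)^-1.

Definition max_steps n : nat := (100 * n ^ 3)%N.

End TradeOff.

Section Algorithm.
Context {R : realType} {n N : nat}.
Implicit Types (t u v : 'rV[R]_n) (Y : 'I_N -> 'rV[R]_n).

(* Which admissible pair (i, k) the search returns is left open. *)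
Definition reduction_step Y t t' :=
  exists (i : 'I_N) (k : int),
    t' = t - k%:~R *: Y i /\ enorm t' ^+ 2 <= shrink n * enorm t ^+ 2.

(* [reduction_run Y m t u]: with at most [m] further steps allowed, the loop
   started in [t] can stop in [u]. *)
Inductive reduction_run Y : nat -> 'rV[R]_n -> 'rV[R]_n -> Prop :=
| run_limit t : reduction_run Y 0 t t
| run_stuck m t :
    (forall t', ~ reduction_step Y t t') -> reduction_run Y m t t
| run_step m t t' u :
    reduction_step Y t t' -> reduction_run Y m t' u ->
    reduction_run Y m.+1 t u.

(* [t0] is the starting vector, in the coset of the target [t]. Since
   [u] stays in this coset, the lattice vector close to [t] is [t - u]. *)
Definition gdd_output Y t0 t y :=
  exists2 u, reduction_run Y (max_steps n) t0 u & y = t - u.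

End Algorithm.

(* Results paired with a number of unit-cost operations: arithmetic operations,
   comparisons and integer roundings on reals. *)
Definition timed (A : Type) : Type := (A * nat)%type.

Definition ret {A : Type} (a : A) : timed A := (a, 0%N).

Definition bind {A B : Type} (x : timed A) (f : A -> timed B) : timed B :=
  let y := f x.1 in (y.1, (x.2 + y.2)%N).

Notation "'let!' x ':=' e1 'in' e2" := (bind e1 (fun x => e2))
  (at level 200, x name, e1 at level 100, e2 at level 200).

Section TimedAlgorithm.
Context {R : realType} {n : nat}.
Implicit Types (t u v y : 'rV[R]_n) (ys : seq 'rV[R]_n).

Definition op_mul (a b : R) : timed R := (a * b, 1%N).

Definition op_div (a b : R) : timed R := (a / b, 1%N).

Definition op_le (a b : R) : timed bool := (a <= b, 1%N).

Definition op_round (a : R) : timed int := (Num.floor (a + 2^-1), 1%N).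

Definition op_shrink : timed R := (shrink n, 3%N).

Definition op_dotp u v : timed R := (dotp u v, (2 * n)%N).

Definition op_sub u v : timed 'rV[R]_n := (u - v, n).

Definition op_sub_scale u (k : int) v : timed 'rV[R]_n :=
  (u - k%:~R *: v, (2 * n)%N).

(* For each [y], only the integer [k] minimizing the norm of [t - k y] has to
   be tried. For [y = 0] the convention [a / 0 = 0] gives [k = 0]. *)
Fixpoint search ys t : timed (option 'rV[R]_n) :=
  if ys is y :: ys' then
    let! ty := op_dotp t y in
    let! yy := op_dotp y y in
    let! q := op_div ty yy in
    let! k := op_round q in
    let! t' := op_sub_scale t k y in
    let! sq' := op_dotp t' t' in
    let! sq := op_dotp t t in
    let! f := op_shrink in
    let! bound := op_mul f sq in
    let! found := op_le sq' bound in
    if found then ret (Some t') else search ys' t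
  else ret None.

Fixpoint reduce ys (m : nat) t : timed 'rV[R]_n :=
  if m is m'.+1 then
    let! r := search ys t in
    if r is Some t' then reduce ys m' t' else ret t
  else ret t.

Definition gdd_query (babai : 'rV[R]_n -> timed 'rV[R]_n) N
    (Y : 'I_N -> 'rV[R]_n) t : timed 'rV[R]_n :=
  let! t0 := babai t in
  let! u := reduce [seq Y i | i <- enum 'I_N] (max_steps n) t0 in
  op_sub t u.

(* The guarantee of Babai's algorithm on the lattice [L] with smoothing
   parameter [eta], run within [cost] operations. *)
Definition babai_spec (L : set 'rV[R]_n) (eta : R) (cost : nat)
    (babai : 'rV[R]_n -> timed 'rV[R]_n) :=
  forall t, [/\ L ((babai t).1 - t),
                enorm (babai t).1 <= 2 ^+ n * eta &
                ((babai t).2 <= cost)%N].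

End TimedAlgorithm.

(* Main.v *)
Require Import Defs.
From mathcomp Require Import all_boot all_order all_algebra.
From mathcomp Require Import all_classical all_reals all_analysis.
From mathcomp Require Import ring lra zify.

Set Implicit Arguments.
Unset Strict Implicit.
Unset Printing Implicit Defensive.

Import Order.TTheory GRing.Theory Num.Theory.
Import numFieldNormedType.Exports.
Local Open Scope classical_set_scope.
Local Open Scope ring_scope.

(* A target longer than d can be shortened as soon as some sample y has norm at
   most sqrt n * eta and makes a large enough inner product, about
   n^(1/2 - alpha) * eta / sqrt pi, with the direction of the target. Poisson
   summation and the definition of eta show that all shifted Gaussian sums of
   the lattice lie within a factor 3 of each other. This bounds the moment
   generating function of <y, u> on both sides for every unit vector u, and an
   exponential tilt gives such a y with probability at least
   2 * exp (- (n^(1/2 - alpha) + 4)^2); the norm condition costs an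
   exponentially small correction. N_alpha samples then fail for a given
   direction with probability at most exp (- 2 n^2), which beats the size of a
   net of directions. Finally 100 n^3 shortening steps suffice to go from
   2^n * eta below eta. *)

(** * Absolutely convergent sums over arbitrary index types *)

(** No Fourier analysis is used: over the integers a finite identity for powers of the cosine passes
    to the limit by dominated convergence, and quadratic forms follow by induction on the dimension.
    Normalising constants are never computed, since only ratios of Gaussian sums matter. The vectors
    met by the loop depend on the samples, so no probability can be attached to a single step.
    Coverage is therefore required for all directions of a fixed net at once; on that event no
    vector longer than [d] is stuck, whatever the target and whatever the search returns. The [+ 4]
    in the exponent of [Nalpha] pays for two losses, with [x = n^(1/2 - alpha)]. Tilting controls
    only a window [t - 1 <= Z <= t + 1], so the probability is governed by [t + 1] and the inner
    product by [t - 1]; passing from a net point to the true direction costs another 1/8. With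
    [t + 1 = (x + 4) / sqrt pi] at least [0.55 x] remains. The lower bound on [alpha] gives
    [x^2 <= n / 16], which keeps the tilted probability above the tail of long vectors. *)

Section AbsoluteSums.
Context {R : realType}.
Implicit Types (T : choiceType).

Definition nsum {T} (u : T -> R) : \bar R := (\esum_(i in [set: T]) (u i)%:E)%E.

Definition summ {T} (f : T -> R) : Prop := (nsum (fun i => `|f i|)%R < +oo)%E.

(* Both sums have nonnegative terms. The value is meaningful only for [summ f]:
   [fine] sends an infinite sum to 0. *)
Definition rsum {T} (f : T -> R) : R :=
  fine (nsum (fun i => `|f i| + f i)%R) - fine (nsum (fun i => `|f i|)%R).

Lemma nsum_ge0 {T} (u : T -> R) : (forall i, 0 <= u i) -> (0 <= nsum u)%E.
Proof. by move=> u0; apply: esum_ge0 => i _; rewrite lee_fin. Qed.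

Lemma nsum_fin {T} (u : T -> R) : (forall i, 0 <= u i) ->
  (nsum u < +oo)%E -> nsum u \is a fin_num.
Proof. by move=> u0 uoo; rewrite ge0_fin_numE// nsum_ge0. Qed.

Lemma le_nsum {T} (u v : T -> R) : (forall i, u i <= v i) -> (nsum u <= nsum v)%E.
Proof. by move=> uv; apply: le_esum => i _; rewrite lee_fin. Qed.

Lemma nsumD {T} (u v : T -> R) : (forall i, 0 <= u i) -> (forall i, 0 <= v i) ->
  nsum (fun i => u i + v i)%R = (nsum u + nsum v)%E.
Proof.
move=> u0 v0; rewrite /nsum -esumD// => i _; by rewrite ?lee_fin.
Qed.

Lemma summ_le {T} (f g : T -> R) : (forall i, `|f i| <= g i) -> summ g -> summ f.
Proof.
move=> fg; apply: le_lt_trans; apply: le_nsum => i.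
exact: (le_trans (fg i) (ler_norm _)).
Qed.

Lemma summD {T} (f g : T -> R) : summ f -> summ g -> summ (fun i => f i + g i).
Proof.
move=> sf sg; apply: le_lt_trans (_ : nsum (fun i => `|f i| + `|g i|)%R < +oo)%E.
  by apply: le_nsum => i; exact: ler_normD.
by rewrite nsumD// lte_add_pinfty.
Qed.

Lemma summN {T} (f : T -> R) : summ f -> summ (fun i => - f i).
Proof. by rewrite /summ (_ : (fun i => `|- f i|) = (fun i => `|f i|))//; apply/funext => i; rewrite normrN. Qed.

Lemma summ_norm {T} (f : T -> R) : summ f -> summ (fun i => `|f i|).
Proof. by rewrite /summ (_ : (fun i => `| `|f i| |) = (fun i => `|f i|))//; apply/funext => i; rewrite normr_id. Qed.

(** Two splittings of one function into nonnegative parts agree after adding them crosswise, so any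
    summable splitting computes [rsum]. The linearity rules below rest on this freedom. *)
Lemma rsum_diff {T} (u v : T -> R) : (forall i, 0 <= u i) -> (forall i, 0 <= v i) ->
  (nsum u < +oo)%E -> (nsum v < +oo)%E ->
  rsum (fun i => u i - v i) = fine (nsum u) - fine (nsum v).
Proof.
move=> u0 v0 su sv; rewrite /rsum.
set f := fun i => u i - v i.
have fn0 i : 0 <= `|f i| + f i by rewrite addrC -lerBlDr sub0r lerNl -normrN ler_norm.
have sf : summ f.
  apply: (@summ_le _ _ (fun i => u i + v i)) => [i|].
    by rewrite (le_trans (ler_normB _ _))// !ger0_norm.
  rewrite /summ; under eq_fun do rewrite ger0_norm ?addr_ge0//.
  by rewrite nsumD// lte_add_pinfty.
have sfn : (nsum (fun i => `|f i| + f i)%R < +oo)%E.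
  apply: le_lt_trans (_ : nsum (fun i => `|f i| + `|f i|)%R < +oo)%E.
    by apply: le_nsum => i; rewrite lerD2l ler_norm.
  by rewrite nsumD// lte_add_pinfty.
have e : (nsum (fun i => (`|f i| + f i))%R + nsum v = nsum (fun i => `|f i|)%R + nsum u)%E.
  by rewrite -!nsumD//; congr nsum; apply/funext => i; rewrite /f; ring.
have := congr1 fine e; rewrite !fineD ?nsum_fin// => h.
by move: h; lra.
Qed.

(** Summability is not assumed: for a divergent sum both sides are 0, since [fine] sends [+oo] to
    0. *)
Lemma rsum_ge0E {T} (u : T -> R) : (forall i, 0 <= u i) -> rsum u = fine (nsum u).
Proof.
move=> u0; rewrite /rsum.
have -> : (fun i => `|u i|) = u by apply/funext => i; rewrite ger0_norm.
have -> : (fun i => `|u i| + u i) = (fun i => u i + u i).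
  by apply/funext => i; rewrite ger0_norm.
rewrite nsumD//; have := nsum_ge0 u0.
by case: (nsum u) => [r||] //= _; rewrite ?addrK ?subr0.
Qed.

Lemma rsumE {T} (u : T -> R) : (forall i, 0 <= u i) -> summ u -> (rsum u)%:E = nsum u.
Proof.
move=> u0 su; rewrite rsum_ge0E// fineK// nsum_fin//.
by move: su; rewrite /summ; under eq_fun do rewrite ger0_norm//.
Qed.

Lemma summE {T} (u : T -> R) : (forall i, 0 <= u i) -> summ u = (nsum u < +oo)%E :> Prop.
Proof. by move=> u0; rewrite /summ; under eq_fun do rewrite ger0_norm//. Qed.

Lemma eq_rsum {T} (f g : T -> R) : f =1 g -> rsum f = rsum g.
Proof. by move=> /funext->. Qed.

Lemma eq_summ {T} (f g : T -> R) : f =1 g -> summ f -> summ g.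
Proof. by move=> /funext->. Qed.

Local Notation pos f := (fun i => `|f i| + f i).

Lemma pos_ge0 {T} (f : T -> R) i : 0 <= `|f i| + f i.
Proof. by rewrite addrC -lerBlDr sub0r lerNl -normrN ler_norm. Qed.

Lemma summ_pos {T} (f : T -> R) : summ f -> (nsum (pos f) < +oo)%E.
Proof.
move=> sf; apply: le_lt_trans (_ : nsum (fun i => `|f i| + `|f i|)%R < +oo)%E.
  by apply: le_nsum => i; rewrite lerD2l ler_norm.
by rewrite nsumD// lte_add_pinfty.
Qed.

Lemma rsumD {T} (f g : T -> R) : summ f -> summ g ->
  rsum (fun i => f i + g i) = rsum f + rsum g.
Proof.
move=> sf sg.
have -> : (fun i => f i + g i) = (fun i => ((`|f i| + f i) + (`|g i| + g i)) - (`|f i| + `|g i|)).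
  by apply/funext => i; ring.
set p := fun i => `|f i| + f i; set q := fun i => `|g i| + g i.
set u := fun i => `|f i|; set v := fun i => `|g i|.
have p0 i : 0 <= p i by exact: pos_ge0.
have q0 i : 0 <= q i by exact: pos_ge0.
have u0 i : 0 <= u i by exact: normr_ge0.
have v0 i : 0 <= v i by exact: normr_ge0.
have sp : (nsum p < +oo)%E by exact: summ_pos.
have sq : (nsum q < +oo)%E by exact: summ_pos.
have su : (nsum u < +oo)%E by [].
have sv : (nsum v < +oo)%E by [].
rewrite (@rsum_diff _ (fun i => p i + q i) (fun i => u i + v i)).
- rewrite !(@nsumD _ p q, @nsumD _ u v)// !fineD ?nsum_fin// /rsum -/p -/q -/u -/v.
  by lra.
- by move=> i; rewrite addr_ge0.
- by move=> i; rewrite addr_ge0.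
- by rewrite nsumD ?lte_add_pinfty.
- by rewrite nsumD ?lte_add_pinfty.
Qed.

Lemma rsumN {T} (f : T -> R) : summ f -> rsum (fun i => - f i) = - rsum f.
Proof.
move=> sf.
have -> : (fun i => - f i) = (fun i => `|f i| - (`|f i| + f i)).
  by apply/funext => i; ring.
rewrite rsum_diff ?summ_pos//; last by move=> i; exact: pos_ge0.
by rewrite /rsum opprB.
Qed.

Lemma rsumB {T} (f g : T -> R) : summ f -> summ g ->
  rsum (fun i => f i - g i) = rsum f - rsum g.
Proof. by move=> sf sg; rewrite rsumD ?rsumN//; exact: summN. Qed.

Lemma ler_rsum {T} (f g : T -> R) : summ f -> summ g -> (forall i, f i <= g i) ->
  rsum f <= rsum g.
Proof.
move=> sf sg fg; rewrite -subr_ge0 -rsumB// rsum_ge0E; first by rewrite fine_ge0// nsum_ge0// => i; rewrite subr_ge0.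
by move=> i; rewrite subr_ge0.
Qed.

Lemma rsum_ge0 {T} (f : T -> R) : (forall i, 0 <= f i) -> 0 <= rsum f.
Proof. by move=> f0; rewrite rsum_ge0E// fine_ge0// nsum_ge0. Qed.

Lemma ler_norm_rsum {T} (f : T -> R) : summ f -> `|rsum f| <= rsum (fun i => `|f i|).
Proof.
move=> sf; have sn := summ_norm sf.
rewrite ler_norml -rsumN//; apply/andP; split; apply: ler_rsum => //.
- exact: summN.
- by move=> i; rewrite lerNl -normrN ler_norm.
- by move=> i; rewrite ler_norm.
Qed.

Lemma nsumZ {T} c (u : T -> R) : 0 <= c -> (forall i, 0 <= u i) ->
  nsum (fun i => c * u i)%R = (c%:E * nsum u)%E.
Proof.
move=> c0 u0; have [->|cN0] := eqVneq c 0.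
  by rewrite mul0e /nsum esum1// => i _; rewrite mul0r.
have {cN0} c0 : 0 < c by rewrite lt_neqAle eq_sym cN0.
have le d (v : T -> R) : 0 < d -> (forall i, 0 <= v i) ->
    (nsum (fun i => d * v i)%R <= d%:E * nsum v)%E.
  move=> d0 v0; apply: ge_ereal_sup => _ [X XT <-].
  rewrite fsbig_finite/=; last by case: XT.
  under eq_bigr do rewrite EFinM.
  rewrite -ge0_sume_distrr; last by move=> i _; rewrite lee_fin.
  rewrite -fsbig_finite/=; last by case: XT.
  by rewrite lee_pmul2l// ?fin_numE//; apply: ereal_sup_ubound; exists X.
(* The converse inequality is [le] with the factor [c^-1], applied to [c * u]. *)
apply/eqP; rewrite eq_le le//= -lee_pdivlMl//.
apply: le_trans (le c^-1 _ _ _); rewrite ?invr_gt0//.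
  by apply: le_nsum => i; rewrite mulrA mulVf ?mul1r ?gt_eqF.
by move=> i; rewrite mulr_ge0// ltW.
Qed.

Lemma summZ {T} c (f : T -> R) : summ f -> summ (fun i => c * f i).
Proof.
move=> sf; rewrite /summ; under eq_fun do rewrite normrM.
rewrite nsumZ//; apply: lte_mul_pinfty => //.
Qed.

Lemma rsumZ {T} c (f : T -> R) : summ f -> rsum (fun i => c * f i) = c * rsum f.
Proof.
wlog c0 : c / 0 <= c => [H sf|sf].
  have [/H->//|/ltW c0] := leP 0 c.
  have := H (- c) _ sf; rewrite oppr_ge0 => /(_ c0) h.
  rewrite -[LHS]opprK -rsumN; last exact: summZ.
  under eq_rsum do rewrite -mulNr.
  by rewrite h mulNr opprK.
have -> : (fun i => c * f i) = (fun i => c * (`|f i| + f i) - c * `|f i|).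
  by apply/funext => i; ring.
rewrite rsum_diff.
- rewrite !nsumZ//; last by move=> i; exact: pos_ge0.
  rewrite !fineM ?nsum_fin ?summ_pos// -?mulrBr//; move=> i; exact: pos_ge0.
- by move=> i; rewrite mulr_ge0 ?pos_ge0.
- by move=> i; rewrite mulr_ge0.
- rewrite nsumZ//; last by move=> i; exact: pos_ge0.
  by apply: lte_mul_pinfty => //; rewrite ?summ_pos.
- by rewrite nsumZ//; apply: lte_mul_pinfty.
Qed.

Lemma summZr {T} c (f : T -> R) : summ f -> summ (fun i => f i * c).
Proof. by move=> sf; apply: (@eq_summ _ (fun i => c * f i)) => [i|]; [rewrite mulrC|exact: summZ]. Qed.

Lemma nsum_bij {T T'} (e : T -> T') (u : T' -> R) : bijective e ->
  nsum u = nsum (fun i => u (e i))%R.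
Proof.
move=> be; rewrite /nsum (reindex_esum setT setT e)//.
by rewrite setTT_bijective.
Qed.

Lemma rsum_bij {T T'} (e : T -> T') (f : T' -> R) : bijective e ->
  rsum f = rsum (fun i => f (e i)).
Proof. by move=> be; rewrite /rsum !(nsum_bij _ be). Qed.

Lemma summ_bij {T T'} (e : T -> T') (f : T' -> R) : bijective e ->
  summ f = summ (fun i => f (e i)).
Proof. by move=> be; rewrite /summ !(nsum_bij _ be). Qed.

Lemma nsum_pair {T T'} (u : T * T' -> R) : (forall p, 0 <= u p) ->
  nsum u = (\esum_(i in [set: T]) nsum (fun j => u (i, j)))%E.
Proof.
move=> u0; rewrite [RHS](@esum_esum _ _ _ setT (fun=> setT) (fun i j => (u (i, j))%:E)).
  rewrite /nsum; have -> : [set: T] `*`` (fun=> [set: T']) = setT by apply/seteqP; split.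
  by apply: eq_esum => -[].
by move=> i j _ _; rewrite lee_fin.
Qed.

Lemma summ_slice {T T'} (f : T * T' -> R) i : summ f -> summ (fun j => f (i, j)).
Proof.
rewrite /summ nsum_pair//; apply: le_lt_trans.
rewrite -(@esum_set1 _ _ i (fun i => nsum (fun j => `|f (i, j)|))) ?nsum_ge0//.
rewrite esum_mkcond; apply: le_esum => k _; case: ifP => // _.
by rewrite nsum_ge0.
Qed.

(** Tonelli's theorem [nsum_pair] applies to the two nonnegative functions in the definition of
    [rsum]; [rsum_diff] subtracts the results. *)
Lemma rsum_pair {T T'} (f : T * T' -> R) : summ f ->
  rsum f = rsum (fun i => rsum (fun j => f (i, j))).
Proof.
move=> sf.
have key (u : T * T' -> R) : (forall p, 0 <= u p) -> (nsum u < +oo)%E ->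
    (forall i, 0 <= fine (nsum (fun j => u (i, j)))) /\
    nsum u = nsum (fun i => fine (nsum (fun j => u (i, j))))%R.
  move=> u0 su; split=> [i|]; first by rewrite fine_ge0 ?nsum_ge0.
  rewrite nsum_pair//; apply: eq_esum => i _; rewrite fineK// nsum_fin//.
  by rewrite -summE//; apply: summ_slice; rewrite summE.
have [p1 p2] := key _ (pos_ge0 f) (summ_pos sf).
have [n1 n2] := key _ (fun p => normr_ge0 (f p)) sf.
rewrite {1}/rsum p2 n2 -rsum_diff -?p2 -?n2 ?summ_pos//.
Qed.

Lemma summ_rsum {T T'} (f : T * T' -> R) : summ f ->
  summ (fun i => rsum (fun j => f (i, j))).
Proof.
move=> sf; apply: (@summ_le _ _ (fun i => rsum (fun j => `|f (i, j)|))) => [i|].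
  by apply: ler_norm_rsum; exact: summ_slice.
rewrite summE; last by move=> i; exact: rsum_ge0.
suff <- : nsum (fun p => `|f p|) = nsum (fun i => rsum (fun j => `|f (i, j)|))%R by [].
rewrite nsum_pair//; apply: eq_esum => i _; rewrite rsumE//.
by apply: summ_norm; exact: summ_slice.
Qed.

Lemma summ_pair {T T'} (f : T * T' -> R) (g : T -> R) :
  (forall i, summ (fun j => f (i, j))) ->
  (forall i, rsum (fun j => `|f (i, j)|) <= g i) -> summ g -> summ f.
Proof.
move=> sf fg sg; rewrite /summ nsum_pair//; apply: le_lt_trans sg.
apply: le_esum => i _; rewrite -rsumE//; last by apply: summ_norm.
by rewrite lee_fin (le_trans (fg i))// ler_norm.
Qed.

Lemma rsum_exchange {T T'} (f : T -> T' -> R) : summ (fun p => f p.1 p.2) ->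
  rsum (fun i => rsum (f i)) = rsum (fun j => rsum (f ^~ j)).
Proof.
move=> sf; rewrite -(@rsum_pair _ _ (fun p => f p.1 p.2))//.
have sw : bijective (fun p : T' * T => (p.2, p.1)).
  by exists (fun p => (p.2, p.1)) => -[].
rewrite (rsum_bij _ sw) (@rsum_pair _ _ (fun p => f p.2 p.1))//.
by rewrite -(@summ_bij _ _ _ (fun p => f p.1 p.2) sw).
Qed.

Lemma sum_seq_le_nsum {T} (u : T -> R) (s : seq T) : uniq s -> (forall i, 0 <= u i) ->
  ((\sum_(i <- s) u i)%:E <= nsum u)%E.
Proof.
move=> us u0; rewrite /nsum /esum -sumEFin fsbig_seq//.
by apply: ereal_sup_ubound; exists [set` s] => //; split=> //; exact: finite_seq.
Qed.

Lemma nsum_gt_seq {T} (u : T -> R) c : (c%:E < nsum u)%E ->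
  exists2 s : seq T, uniq s & c < \sum_(i <- s) u i.
Proof.
move=> /ereal_sup_gt[_ [X [fX _]] <-].
rewrite fsbig_finite//= sumEFin lte_fin => cX.
exists (finmap.enum_fset (fset_set X)) => //; exact: finmap.fset_uniq.
Qed.

Lemma sum_seq_le_rsum {T} (u : T -> R) (s : seq T) : uniq s -> (forall i, 0 <= u i) ->
  summ u -> \sum_(i <- s) u i <= rsum u.
Proof. by move=> us u0 su; rewrite -lee_fin rsumE// sum_seq_le_nsum. Qed.

Lemma rsum_gt0 {T} (u : T -> R) i : (forall i, 0 <= u i) -> summ u -> 0 < u i ->
  0 < rsum u.
Proof.
move=> u0 su ui; apply: lt_le_trans (_ : \sum_(j <- [:: i]) u j <= _).
  by rewrite big_seq1.
exact: sum_seq_le_rsum.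
Qed.

Lemma summ_bound {T} (u : T -> R) B : (forall i, 0 <= u i) ->
  (forall s : seq T, uniq s -> \sum_(i <- s) u i <= B) -> summ u.
Proof.
move=> u0 uB; rewrite summE//; apply: le_lt_trans (ltry B).
rewrite leNgt; apply/negP => /nsum_gt_seq[s us]; apply/negP.
by rewrite -leNgt uB.
Qed.

Lemma rsum_le {T} (u : T -> R) B : (forall i, 0 <= u i) ->
  (forall s : seq T, uniq s -> \sum_(i <- s) u i <= B) -> rsum u <= B.
Proof.
move=> u0 uB; have su := summ_bound u0 uB.
rewrite -lee_fin rsumE// leNgt; apply/negP => /nsum_gt_seq[s us]; apply/negP.
by rewrite -leNgt uB.
Qed.

Lemma rsum_seq {T} (s : seq T) (f : T -> R) : uniq s ->
  (forall i, i \notin s -> f i = 0) -> summ f /\ rsum f = \sum_(i <- s) f i.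
Proof.
move=> us f0.
have key (u : T -> R) : (forall i, 0 <= u i) -> (forall i, i \notin s -> u i = 0) ->
    nsum u = (\sum_(i <- s) u i)%:E.
  move=> u0 us0; rewrite /nsum -sumEFin fsbig_seq// -esum_fset//; last first.
    by move=> i _; rewrite lee_fin.
  rewrite [RHS]esum_mkcond; apply: eq_esum => i _; case: ifPn => //.
  by rewrite notin_setE => /negP /us0 ->.
have k1 : nsum (fun i => `|f i|) = (\sum_(i <- s) `|f i|)%:E.
  by apply: key => // i /f0 ->; rewrite normr0.
have k2 : nsum (fun i => `|f i| + f i)%R = (\sum_(i <- s) (`|f i| + f i))%:E.
  by apply: key => [i|i /f0 ->]; [exact: pos_ge0|rewrite normr0 addr0].
split; first by rewrite /summ k1 ltry.
by rewrite /rsum k1 k2 /= big_split/= addrAC subrr add0r.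
Qed.

Lemma rsum_tail {T} (g : T -> R) e : (forall i, 0 <= g i) -> summ g -> 0 < e ->
  exists2 s : seq T, uniq s & rsum g - e < \sum_(i <- s) g i.
Proof.
move=> g0 sg e0; apply: nsum_gt_seq; rewrite -rsumE// lte_fin.
by rewrite ltrBlDr ltrDl.
Qed.

Lemma rsum_split_seq {T} (g : T -> R) (s : seq T) : uniq s -> summ g ->
  summ (fun i => if i \in s then 0 else g i) /\
  rsum g = \sum_(i <- s) g i + rsum (fun i => if i \in s then 0 else g i).
Proof.
move=> us sg.
have [sh rh] := @rsum_seq _ s (fun i => if i \in s then g i else 0) us
  (fun i h => ifN _ _ h).
have st : summ (fun i => if i \in s then 0 else g i).
  apply: summ_le (summ_norm sg) => i; case: ifP => // _; rewrite normr0.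
  exact: normr_ge0.
split=> //.
have -> : \sum_(i <- s) g i = rsum (fun i => if i \in s then g i else 0).
  by rewrite rh big_seq [RHS]big_seq; apply: eq_bigr => i ->.
rewrite -rsumD//; apply: eq_rsum => i; by case: ifP; rewrite ?addr0 ?add0r.
Qed.

Lemma cvg_sum_seq {I : Type} (s : seq I) (f : nat -> I -> R) (f_ : I -> R) :
  (forall i, f k i @[k --> \oo] --> f_ i) ->
  \sum_(i <- s) f k i @[k --> \oo] --> \sum_(i <- s) f_ i.
Proof.
move=> ff; elim: s => [|i s IH].
  by rewrite big_nil; under eq_cvg do rewrite big_nil; exact: cvg_cst.
by rewrite big_cons; under eq_cvg do rewrite big_cons; exact: cvgD.
Qed.

(* Tannery's theorem *)
Lemma cvg_rsum {T} (f : nat -> T -> R) (f_ g : T -> R) :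
  summ g -> (\forall k \near \oo, forall i, `|f k i| <= g i) ->
  (forall i, f k i @[k --> \oo] --> f_ i) ->
  (\forall k \near \oo, summ (f k)) /\ summ f_ /\
  rsum (f k) @[k --> \oo] --> rsum f_.
Proof.
move=> sg fg ff.
have g0 i : 0 <= g i.
  have [k /(_ k (leqnn k))/(_ i)] : exists k, forall m, (k <= m)%N ->
      forall i, `|f m i| <= g i.
    by case: fg => N _ H; exists N => m; exact: H.
  exact: le_trans.
have f_g i : `|f_ i| <= g i.
  have /cvgr_to_le : `|f k i| @[k --> \oo] --> `|f_ i| by apply: cvg_norm.
  by apply; near=> k; near: k; apply: filterS fg => k; apply.
have sf_ : summ f_ by exact: summ_le sg.
have sfk : \forall k \near \oo, summ (f k).
  by apply: filterS fg => k /summ_le; apply.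
split=> //; split=> //; apply/cvgrPdist_le => e e0.
(* Three errors of at most [e / 4] each: the finite sum over [s], and the tails of [f k] and of
   [f_], both dominated by the tail of [g]. *)
have e4 : 0 < e / 4 by rewrite divr_gt0.
have [s us sge] := rsum_tail g0 sg e4.
have [tg rg] := rsum_split_seq us sg.
have cs : \sum_(i <- s) f k i @[k --> \oo] --> \sum_(i <- s) f_ i.
  exact: cvg_sum_seq.
have /cvgrPdist_le/(_ _ e4) cs4 := cs.
near=> k.
have sk : summ (f k) by near: k.
have fk : forall i, `|f k i| <= g i by near: k.
have [t1 r1] := rsum_split_seq us sk.
have [t2 r2] := rsum_split_seq us sf_.
set G := rsum (fun i => if i \in s then 0 else g i) in rg.
have tailb (h : T -> R) : (forall i, `|h i| <= g i) ->
    `|rsum (fun i => if i \in s then 0 else h i)| <= G.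
  move=> hg; have th : summ (fun i => if i \in s then 0 else h i).
    by apply: (rsum_split_seq us _).1; exact: summ_le sg.
  apply: le_trans (ler_norm_rsum th) _; apply: ler_rsum => //; first exact: summ_norm.
  by move=> i; case: ifP => // _; rewrite normr0.
have GA := tailb _ fk.
have GB := tailb _ f_g.
have Ge : G <= e / 4 by move: sge; rewrite rg; lra.
have c4 : `|\sum_(i <- s) f_ i - \sum_(i <- s) f k i| <= e / 4 by near: k.
rewrite r1 r2.
move: GA GB c4; set A := rsum (fun i => if i \in s then 0 else f k i).
set B := rsum (fun i => if i \in s then 0 else f_ i); rewrite !ler_norml => /andP[a1 a2] /andP[b1 b2] /andP[c1 c2].
by apply/andP; split; lra.
Unshelve. all: by end_near. Qed.

Lemma rsum_fin {I : finType} (f : I -> R) : summ f /\ rsum f = \sum_i f i.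
Proof.
have f0 i : i \notin enum I -> f i = 0 by rewrite mem_enum.
have [sf ->] := rsum_seq (enum_uniq I) f0.
by rewrite big_enum.
Qed.

End AbsoluteSums.

(** * Poisson summation over the integers *)

Section Trigonometry.
Context {R : realType}.
Implicit Types (x y a b : R).

(** Iterated below to obtain the alternating Taylor bounds: each difference has the previous one as
    its derivative. *)
Lemma ge0_from_derive (f df : R -> R) x : (forall y, is_derive y 1 f (df y)) ->
  (forall y, 0 <= y -> 0 <= df y) -> 0 <= f 0 -> 0 <= x -> 0 <= f x.
Proof.
move=> fdf df0 f0 x0.
have cf : {within `[0, x], continuous f}.
  apply: continuous_subspaceT => y; apply: differentiable_continuous.
  by apply/derivable1_diffP; exact: (@ex_derive _ _ _ _ _ _ _ (fdf y)).
have [c /[!in_itv]/= /andP[c0 _]] := @MVT_segment R f df 0 x x0 (fun y _ => fdf y) cf.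
rewrite subr0 => e; suff : 0 <= f x - f 0 by move=> h; rewrite -(subrK (f 0) (f x)) addr_ge0.
by rewrite e mulr_ge0 ?df0.
Qed.

Lemma sin_le x : 0 <= x -> sin x <= x.
Proof.
move=> x0; rewrite -subr_ge0.
apply: (@ge0_from_derive (fun y => y - sin y) (fun y => 1 - cos y)) => //.
- by rewrite sin0 subr0.
Qed.

Lemma cos_ge x : 0 <= x -> 1 - x ^+ 2 / 2 <= cos x.
Proof.
move=> x0; rewrite -subr_ge0.
apply: (@ge0_from_derive (fun y => cos y - (1 - y ^+ 2 / 2)) (fun y => y - sin y)) => //.
- by move=> y; apply: is_derive_eq; rewrite /GRing.scale/=; field.
- by move=> y y0; rewrite subr_ge0 sin_le.
- by rewrite cos0 expr0n/= mul0r subr0 subrr.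
Qed.

Lemma sin_ge x : 0 <= x -> x - x ^+ 3 / 6 <= sin x.
Proof.
move=> x0; rewrite -subr_ge0.
apply: (@ge0_from_derive (fun y => sin y - (y - y ^+ 3 / 6))
  (fun y => cos y - (1 - y ^+ 2 / 2))) => //.
- by move=> y; apply: is_derive_eq; rewrite /GRing.scale/=; field.
- by move=> y y0; rewrite subr_ge0 cos_ge.
- by rewrite sin0 expr0n/= mul0r subr0 subrr.
Qed.

Lemma cos_le x : 0 <= x -> cos x <= 1 - x ^+ 2 / 2 + x ^+ 4 / 24.
Proof.
move=> x0; rewrite -subr_ge0.
apply: (@ge0_from_derive (fun y => (1 - y ^+ 2 / 2 + y ^+ 4 / 24) - cos y)
  (fun y => sin y - (y - y ^+ 3 / 6))) => //.
- by move=> y; apply: is_derive_eq; rewrite /GRing.scale/=; field.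
- by move=> y y0; rewrite subr_ge0 sin_ge.
- by rewrite cos0 !expr0n/= !mul0r subr0 addr0 subrr.
Qed.

Lemma cos_periodz (k : int) x : cos (x + 2 * pi * k%:~R) = cos x.
Proof.
have p n y : cos (y + 2 * pi * n%:R) = cos y :> R.
  by rewrite -(periodicn (@cosD2pi R) n y) -mulr_natr; congr (cos (_ + _)); ring.
case: k => n; first exact: p.
by rewrite NegzE mulrNz mulrN -(p n.+1 (x - _)) subrK.
Qed.

Lemma sin_piz (k : int) : sin (pi * k%:~R) = 0 :> R.
Proof.
have p n : sin (pi * n%:R) = 0 :> R.
  elim: n => [|n IH]; first by rewrite mulr0 sin0.
  by rewrite -natr1 mulrDr mulr1 sinDpi IH oppr0.
case: k => n; first exact: p.
by rewrite NegzE mulrNz mulrN sinN -pmulrn p oppr0.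
Qed.

(** Reducing [q] modulo [l] moves the angle by a multiple of [pi] into the open interval from 0 to
    [pi]. This allows the sine factor of [sum_cos_progression] to be cancelled. *)
Lemma sin_pi_neq0 (q : int) (l : nat) : (0 < l)%N -> ~~ (l %| q)%Z ->
  sin (pi * (q%:~R / l%:R)) != 0 :> R.
Proof.
move=> l0 lq; have l0' : l%:R != 0 :> R by rewrite pnatr_eq0 -lt0n.
have ql : (0 <= (q %% l)%Z)%R by apply: modz_ge0; lia.
have qu : ((q %% l)%Z < l) by apply: ltz_pmod; lia.
have qn : (q %% l)%Z != 0 by apply: contra lq => /eqP h; apply/dvdz_mod0P.
set r := (q %% l)%Z in ql qu qn.
have sr : 0 < sin (pi * (r%:~R / l%:R)) :> R.
  have rl0 : 0 < r%:~R / l%:R :> R by rewrite divr_gt0 ?ltr0n ?ltr0z//; lia.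
  have rl1 : r%:~R / l%:R < 1 :> R.
    by rewrite ltr_pdivrMr ?ltr0n// mul1r -[X in _ < X]/(l%:Z%:~R) ltr_int.
  by apply: sin_gt0_pi; rewrite mulr_gt0 ?pi_gt0//= gtr_pMr ?pi_gt0.
have -> : q%:~R / l%:R = (q %/ l)%Z%:~R + r%:~R / l%:R :> R.
  rewrite {1}(divz_eq q l) -/r intrD intrM; field.
  by [].
rewrite mulrDr sinD sin_piz mul0r add0r mulf_neq0//; last by rewrite gt_eqF.
apply/eqP => c0; have := cos2Dsin2 (pi * (q %/ l)%Z%:~R : R).
by rewrite c0 sin_piz !expr0n/= addr0 => /esym/eqP; rewrite oner_eq0.
Qed.

Lemma cosM_cos a b : cos a * cos b = (cos (b + a) + cos (b - a)) / 2.
Proof. by rewrite cosD cosB; field. Qed.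

(** The real part of the binomial expansion of [((e^(ia) + e^(-ia)) / 2)^n * e^(ib)]. The free phase
    [b] is what lets Pascal's rule carry the induction. *)
Lemma cos_exp_expand n a b : cos a ^+ n * cos b =
  2 ^- n * \sum_(j < n.+1) 'C(n, j)%:R * cos (b + (2 * j%:R - n%:R) * a).
Proof.
elim: n b => [|n IH] b.
  by rewrite big_ord1 bin0 !expr0 invr1 !mul1r mulr0 subrr mul0r addr0.
rewrite exprSr -mulrA cosM_cos mulrA mulrDr mulrDl !IH.
pose c (m : nat) := cos (b + (2 * m%:R - n.+1%:R) * a).
have -> : \sum_(j < n.+1) 'C(n, j)%:R * cos (b + a + (2 * j%:R - n%:R) * a)
    = \sum_(j < n.+1) 'C(n, j)%:R * c j.+1.
  apply: eq_bigr => j _; congr (_ * cos _); rewrite -!natr1; ring.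
have -> : \sum_(j < n.+1) 'C(n, j)%:R * cos (b - a + (2 * j%:R - n%:R) * a)
    = \sum_(j < n.+1) 'C(n, j)%:R * c j.
  apply: eq_bigr => j _; congr (_ * cos _); rewrite -!natr1; ring.
have -> : \sum_(j < n.+2) 'C(n.+1, j)%:R * cos (b + (2 * j%:R - n.+1%:R) * a) =
    \sum_(j < n.+1) 'C(n, j)%:R * c j.+1 + \sum_(j < n.+1) 'C(n, j)%:R * c j.
  rewrite big_ord_recl bin0 -/(c 0%N).
  under eq_bigr do rewrite /bump/= binS natrD mulrDl.
  rewrite big_split/= addrCA addrA addrC; congr (_ + _).
  rewrite [RHS]big_ord_recl bin0 addrC; congr (_ + _).
  by rewrite big_ord_recr/= bin_small// mul0r addr0.
by rewrite exprSr invfM; ring.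
Qed.

(** Multiplication by [sin (d / 2)] makes the sum telescope. The range from [- h] to [h] is
    symmetric, so the two end phases [f + d l / 2] and [f - d l / 2] recombine into a product. *)
Lemma sum_cos_progression (d f : R) (l h : nat) : l = h.*2.+1 ->
  sin (d / 2) * \sum_(v < l) cos (f + d * (v%:R - h%:R)) =
  cos f * sin (d * l%:R / 2).
Proof.
move=> lh.
pose s (v : nat) := sin (f + d * (v%:R - h%:R) - d / 2) / 2.
have step v : sin (d / 2) * cos (f + d * (v%:R - h%:R)) = s v.+1 - s v.
  have -> : s v.+1 = sin (f + d * (v%:R - h%:R) + d / 2) / 2.
    by congr (sin _ / 2); rewrite -natr1; field.
  by rewrite /s sinD sinB; field.
rewrite mulr_sumr; under eq_bigr do rewrite step.
rewrite -(big_mkord xpredT (fun v => s v.+1 - s v)) telescope_sumr//.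
have ll : l%:R = 2 * h%:R + 1 :> R by rewrite lh -natr1 -mul2n natrM.
have -> : s l = sin (f + d * l%:R / 2) / 2.
  by rewrite /s ll; congr (sin _ / 2); field.
have -> : s 0%N = sin (f - d * l%:R / 2) / 2.
  by rewrite /s ll; congr (sin _ / 2); field.
by rewrite sinD sinB; field.
Qed.

(** Orthogonality of the characters of the integers modulo [l], in real form. *)
Lemma sum_cos_period (q : int) (x t : R) (l h : nat) : l = h.*2.+1 ->
  \sum_(v < l) cos (2 * pi * q%:~R * (v%:R - h%:R + x) / l%:R + t) =
  if (l %| q)%Z then l%:R * cos (2 * pi * (q %/ l)%Z%:~R * x + t) else 0.
Proof.
move=> lh; have l0 : l%:R != 0 :> R by rewrite lh pnatr_eq0.
case: ifPn => [/dvdzP[k ->]|lq].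
  rewrite mulzK; last by lia.
  rewrite (eq_bigr (fun=> cos (2 * pi * k%:~R * x + t))).
    by rewrite sumr_const card_ord -[LHS]mulr_natl.
  move=> v _; rewrite -(cos_periodz (k * (v%:Z - h%:Z)) (2 * pi * k%:~R * x + t)).
  congr cos; rewrite !intrM intrB; field.
  by [].
pose d : R := 2 * pi * q%:~R / l%:R; pose f : R := 2 * pi * q%:~R * x / l%:R + t.
have := sum_cos_progression d f lh.
have -> : d * l%:R / 2 = pi * q%:~R by rewrite /d; field.
rewrite sin_piz mulr0.
have -> : d / 2 = pi * (q%:~R / l%:R) by rewrite /d; field.
move/eqP.
have lp : (0 < l)%N by rewrite lh.
rewrite mulf_eq0 (negbTE (sin_pi_neq0 lp lq))/= => /eqP s0; rewrite -[RHS]s0.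
by apply: eq_bigr => v _; congr cos; rewrite /d /f; field.
Qed.

End Trigonometry.

(** * Central binomial coefficients as a discrete Gaussian, and the finite Poisson formula *)

Section CentralBinomial.
Context {R : realType}.
Implicit Types (M : nat) (i : int).

(** The coefficient at distance [i] from the middle of row [2 M], extended by 0: the test handles
    indices below the row, and ['C] already vanishes above it. *)
Definition binz M (i : int) : nat :=
  if 0 <= M%:Z + i then 'C(M.*2, `|M%:Z + i|) else 0%N.

(** Close to [expR (- i^2 / M)] for [i] of order [sqrt M]; this is the Gaussian on the dual side.
    The division moves the growing scale into a factor that is common to all instances of
    [finite_poisson]. *)
Definition bratio M i : R := (binz M i)%:R / 'C(M.*2, M)%:R.

Lemma binz_nat M (j : nat) : binz M j%:Z = 'C(M.*2, M + j).
Proof. by []. Qed.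

Lemma binzN M i : binz M (- i) = binz M i.
Proof.
rewrite /binz; case: ifP => h1; case: ifP => h2.
- have [le|lt] := leqP `|M%:Z + i| M.*2.
    have -> : `|M%:Z - i|%N = (M.*2 - `|(M%:Z + i)%R|)%N by lia.
    exact: bin_sub.
  by rewrite (bin_small lt); lia.
- by rewrite bin_small//; lia.
- by rewrite bin_small//; lia.
- by [].
Qed.

Lemma binz_abs M i : binz M i = binz M `|i|%N%:Z.
Proof. case: (leP 0 i) => h; first by rewrite -[in LHS](gez0_abs h).
by rewrite -binzN -(ltz0_abs h). Qed.

Lemma bin_central_gt0 M : 0 < 'C(M.*2, M)%:R :> R.
Proof. by rewrite ltr0n bin_gt0 -addnn leq_addr. Qed.

Lemma bratio_ge0 M i : 0 <= bratio M i.
Proof. by rewrite divr_ge0// ler0n. Qed.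

Lemma bratio0 M : bratio M 0%:Z = 1.
Proof. by rewrite /bratio binz_nat addn0 divff// gt_eqF ?bin_central_gt0. Qed.

Lemma bratio_abs M i : bratio M i = bratio M `|i|%N%:Z.
Proof. by rewrite /bratio binz_abs. Qed.

Lemma bratioS M (j : nat) : (j <= M)%N ->
  bratio M j.+1%:Z = bratio M j%:Z * ((M%:R - j%:R) / (M%:R + j%:R + 1)).
Proof.
move=> jM; rewrite /bratio !binz_nat.
have e : ((M + j).+1 * 'C(M.*2, (M + j).+1) = (M - j) * 'C(M.*2, M + j))%N.
  by rewrite mul_bin_left; congr (_ * _)%N; lia.
have /(congr1 (fun n => n%:R : R)) := e.
rewrite !natrM natrB// -natr1 natrD addnS => {}e.
have n0 : M%:R + j%:R + 1 != 0 :> R by rewrite gt_eqF// ltr_wpDl// -natrD.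
have c0 := lt0r_neq0 (bin_central_gt0 M).
have -> : 'C(M.*2, (M + j).+1)%:R = (M%:R - j%:R) * 'C(M.*2, M + j)%:R / (M%:R + j%:R + 1) :> R.
  by rewrite -e; field.
by field; rewrite c0 n0.
Qed.

(** Consecutive ratios are [1 - (2 j + 1) / (M + j + 1)], and the odd numbers add up to [j^2]. One
    [J] replaces all the denominators, so that the exponents can be added. *)
Lemma bratio_le_nat M (J j : nat) : (j <= J)%N -> (J <= M)%N -> (0 < M)%N ->
  bratio M j%:Z <= expR (- (j%:R ^+ 2 / (M%:R + J%:R))).
Proof.
move=> + JM M0; elim: j => [|j IH] jJ.
  by rewrite bratio0 expr0n/= mul0r oppr0 expR0.
rewrite bratioS; last by lia.
have MJ : 0 < M%:R + J%:R :> R by rewrite -natrD ltr0n; lia.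
have Mj : 0 < M%:R + j%:R + 1 :> R by rewrite -natrD natr1 ltr0n; lia.
have jM : 0 <= M%:R - j%:R :> R by rewrite subr_ge0 ler_nat; lia.
have -> : - (j.+1%:R ^+ 2 / (M%:R + J%:R)) =
    - (j%:R ^+ 2 / (M%:R + J%:R)) - (2 * j%:R + 1) / (M%:R + J%:R) :> R.
  by rewrite -natr1; field; rewrite gt_eqF.
rewrite expRD ler_pM ?bratio_ge0 ?IH//; first by rewrite divr_ge0// ltW.
  by lia.
apply: le_trans (expR_ge1Dx _).
have -> : (M%:R - j%:R) / (M%:R + j%:R + 1) = 1 - (2 * j%:R + 1) / (M%:R + j%:R + 1) :> R.
  by field; rewrite gt_eqF.
rewrite lerD2l lerN2 ler_wpM2l//.
rewrite lef_pV2 ?posrE// -!natrD natr1 ler_nat; lia.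
Qed.

Lemma bratio_ge_nat M (J j : nat) : (j <= J)%N -> (J < M)%N ->
  expR (- (j%:R ^+ 2 / (M%:R - J%:R))) <= bratio M j%:Z.
Proof.
move=> + JM; elim: j => [|j IH] jJ.
  by rewrite bratio0 expr0n/= mul0r oppr0 expR0.
rewrite bratioS; last by lia.
have MJ : 0 < M%:R - J%:R :> R by rewrite subr_gt0 ltr_nat.
have Mj : 0 < M%:R + j%:R + 1 :> R by rewrite -natrD natr1 ltr0n; lia.
have jM : 0 < M%:R - j%:R :> R by rewrite subr_gt0 ltr_nat; lia.
have -> : - (j.+1%:R ^+ 2 / (M%:R - J%:R)) =
    - (j%:R ^+ 2 / (M%:R - J%:R)) - (2 * j%:R + 1) / (M%:R - J%:R) :> R.
  by rewrite -natr1; field; rewrite gt_eqF.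
rewrite expRD ler_pM ?expR_ge0 ?IH//; first by lia.
rewrite expRN -[leRHS]invf_div lef_pV2 ?posrE ?expR_gt0 ?divr_gt0//.
apply: le_trans (expR_ge1Dx _).
have -> : (M%:R + j%:R + 1) / (M%:R - j%:R) = 1 + (2 * j%:R + 1) / (M%:R - j%:R) :> R.
  by field; rewrite gt_eqF.
rewrite lerD2l ler_wpM2l//.
rewrite lef_pV2 ?posrE// lerB// ler_nat; lia.
Qed.

Lemma sqr_absz_int i : (`|i|%N%:R : R) ^+ 2 = i%:~R ^+ 2.
Proof. by rewrite natr_absz intr_norm -normrX ger0_norm ?sqr_ge0. Qed.

(** The choice [J = M]: not sharp, but valid for every [i], as a dominating function requires. *)
Lemma bratio_le M i : (0 < M)%N -> bratio M i <= expR (- (i%:~R ^+ 2 / (2 * M%:R))).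
Proof.
move=> M0; rewrite bratio_abs -sqr_absz_int; have [iM|Mi] := leqP `|i|%N M.
  rewrite (_ : 2 * M%:R = M%:R + M%:R); last by ring.
  exact: bratio_le_nat.
rewrite /bratio binz_nat bin_small; last by lia.
by rewrite mul0r expR_ge0.
Qed.

(** The choice [J = |i|]: for [i] of order [sqrt M] both exponents have the same limit, which gives
    pointwise convergence. *)
Lemma bratio_bounds M i : (`|i| < M)%N ->
  expR (- (i%:~R ^+ 2 / (M%:R - `|i%:~R|))) <= bratio M i <=
  expR (- (i%:~R ^+ 2 / (M%:R + `|i%:~R|))).
Proof.
move=> iM; rewrite bratio_abs -sqr_absz_int -intr_norm -natr_absz.
by rewrite bratio_ge_nat ?bratio_le_nat//; lia.
Qed.

(* Polya's finite form of the Poisson summation formula: expand the power of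
   the cosine into characters and sum each of them over the period [l]. *)
Lemma finite_poisson (M l h : nat) (p : int) (x t : R) : l = h.*2.+1 ->
  let F := fun z : int => if (`|z| <= h)%N then
     cos (pi * (z%:~R + x) / l%:R) ^+ (M.*2) * cos (2 * pi * p%:~R * (z%:~R + x) / l%:R + t)
     else 0 in
  let G := fun k : int => bratio M (k * l%:Z - p) * cos (2 * pi * k%:~R * x + t) in
  [/\ summ F, summ G & rsum F = l%:R * 2 ^- (M.*2) * 'C(M.*2, M)%:R * rsum G].
Proof.
move=> lh F G; have l0 : l%:R != 0 :> R by rewrite lh pnatr_eq0.
have lp : (0 < l)%N by rewrite lh.
pose sF : seq int := [seq v%:Z - h%:Z | v <- iota 0 l].
have usF : uniq sF by rewrite map_inj_uniq ?iota_uniq// => u v /=; lia.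
have F0 (z : int) : z \notin sF -> F z = 0.
  move=> zs; rewrite /F ifF//; apply: contraNF zs => zh.
  by apply/mapP; exists `|(z + h%:Z)%R|%N; [rewrite mem_iota; lia|lia].
(* The expansion has the frequencies [p + j - M]. Summing over a period keeps only the multiples
   [k * l], and these [k] contain the support of [G]. *)
pose J := [seq j <- iota 0 (M.*2.+1) | (l %| p + j%:Z - M%:Z)%Z].
pose sG : seq int := [seq ((p + j%:Z - M%:Z) %/ l)%Z | j <- J].
have usG : uniq sG.
  rewrite map_inj_in_uniq ?filter_uniq ?iota_uniq//.
  move=> u v; rewrite !mem_filter => /andP[/divzK du _] /andP[/divzK dv _] /(congr1 ( *%R^~ l%:Z)).
  by rewrite du dv; lia.
have G0 (k : int) : k \notin sG -> G k = 0.
  move=> ks; rewrite /G /bratio; have [->|] := eqVneq (binz M (k * l%:Z - p)) 0%N.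
    by rewrite !mul0r.
  rewrite /binz; case: ifP => // kp; rewrite -lt0n bin_gt0 => kp2.
  case/negP: ks; apply/mapP; exists `|(M%:Z + (k * l%:Z - p))%R|%N.
    rewrite mem_filter mem_iota; apply/andP; split; last by lia.
    by apply/dvdzP; exists k; lia.
  by rewrite (_ : p + _ - _ = k * l%:Z); [rewrite mulzK//; lia|lia].
have [sumF ->] := rsum_seq usF F0.
have [sumG ->] := rsum_seq usG G0.
split=> //; rewrite !big_map big_filter.
have -> : \sum_(v <- iota 0 l) F (v%:Z - h%:Z) = \sum_(v < l)
   2 ^- (M.*2) * \sum_(j < M.*2.+1) 'C(M.*2, j)%:R *
     cos (2 * pi * (p + j%:Z - M%:Z)%:~R * (v%:R - h%:R + x) / l%:R + t).
  rewrite -[iota 0 l](_ : index_iota 0 l = _); last by rewrite /index_iota subn0.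
  rewrite big_mkord; apply: eq_bigr => v _; have vl := ltn_ord v; rewrite /F ifT; last by lia.
  rewrite intrB cos_exp_expand; congr (_ * _); apply: eq_bigr => j _.
  congr (_ * cos _); rewrite !intrB intrD (_ : M.*2%:R = 2 * M%:R); [by field|by rewrite -mul2n natrM].
rewrite -mulr_sumr exchange_big/=.
under eq_bigr do rewrite -mulr_sumr (sum_cos_period _ _ _ lh).
rewrite -(mulrA l%:R) (mulrCA l%:R) -[RHS]mulrA; congr (_ * _).
rewrite -[0%N :: _]/(index_iota 0 M.*2.+1).
rewrite [in RHS]big_mkcond/= big_mkord !mulr_sumr; apply: eq_bigr => j _.
case: ifP => [d|_]; last by rewrite !mulr0.
have e : ((p + j%:Z - M%:Z) %/ l)%Z * l%:Z - p = j%:Z - M%:Z by rewrite (divzK d); lia.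
rewrite /G e /bratio /binz ifT; last by lia.
rewrite (_ : `|(M%:Z + (j%:Z - M%:Z))%R|%N = j :> nat); last by lia.
by field; rewrite gt_eqF ?bin_central_gt0.
Qed.

End CentralBinomial.

(** * Summability of Gaussians over the integers *)

Section IntegerGaussian.
Context {R : realType}.

Lemma summ_geometric (r : R) : 0 <= r < 1 -> summ (fun n : nat => r ^+ n).
Proof.
move=> /andP[r0 r1]; have rn n : 0 <= r ^+ n by exact: exprn_ge0.
rewrite summE//; apply: le_lt_trans (ltry (1 - r)^-1).
rewrite /nsum -nneseries_esumT => [|n]; last by rewrite lee_fin.
apply: lime_le; first by apply: is_cvg_nneseries => n _ _; rewrite lee_fin.
apply: nearW => n; rewrite sumEFin lee_fin.
rewrite -[leRHS]mul1r ler_pdivlMr ?subr_gt0// big_mkord.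
have := subrX1 r n; have := rn n; set S := \sum_(_ < _) _.
by move=> + h; rewrite -opprB mulrN mulrC -h; lra.
Qed.

Lemma summ_expn_abs (r : R) : 0 <= r < 1 -> summ (fun z : int => r ^+ `|z|).
Proof.
move=> /andP[r0 r1].
pose e (p : bool * nat) : int := if p.1 then Posz p.2 else Negz p.2.
pose e' (z : int) : bool * nat := match z with Posz n => (true, n) | Negz n => (false, n) end.
have be : bijective e by exists e'; [case=> [[|] n]|case].
rewrite (summ_bij _ be); have sg : summ (fun n : nat => r ^+ n) by apply: summ_geometric; rewrite r0.
have rn n : 0 <= r ^+ n by exact: exprn_ge0.
have le (b : bool) n : `|r ^+ `|e (b, n)| | <= r ^+ n.
  rewrite ger0_norm//; case: b => //=.
  by rewrite exprS ler_piMl// ltW.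
apply: (@summ_pair _ _ _ _ (fun=> rsum (fun n : nat => r ^+ n))) => [b|b|].
- exact: summ_le (le b) sg.
- apply: (ler_rsum _ sg) => [|n]; last exact: (le b n).
  by apply: summ_norm; exact: summ_le (le b) sg.
- exact: (rsum_fin _).1.
Qed.

(** Comparison with a geometric series, by [(z + y)^2 >= z^2 / 2 - y^2] and [z^2 >= |z|]. *)
Lemma summ_gauss (c y : R) : 0 < c ->
  summ (fun z : int => expR (- (c * (z%:~R + y) ^+ 2))).
Proof.
move=> c0; pose r := expR (- (c / 2)).
have r1 : 0 <= r < 1 by rewrite expR_ge0 expR_lt1 oppr_lt0 divr_gt0.
apply: (@summ_le _ _ _ (fun z : int => expR (c * y ^+ 2) * r ^+ `|z|)); last first.
  by apply: summZ; exact: summ_expn_abs.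
move=> z; rewrite ger0_norm ?expR_ge0// -expRM_natr -expRD ler_expR.
have : `|z|%:R <= (z%:~R : R) ^+ 2.
  rewrite -sqr_absz_int -natrX ler_nat. nia.
move=> h; have := sqr_ge0 (z%:~R + 2 * y) => h2.
rewrite -subr_ge0; set w := z%:~R in h h2 *.
have -> : c * y ^+ 2 + - (c / 2) * `|z|%:R - - (c * (w + y) ^+ 2) =
  c / 2 * ((w ^+ 2 - `|z|%:R) + (w + 2 * y) ^+ 2) by field.
by apply: mulr_ge0; [rewrite divr_ge0// ltW|rewrite addr_ge0// subr_ge0].
Qed.

End IntegerGaussian.

(** * Limits and sine estimates for the passage from finite to infinite sums *)

Section Limits.
Context {R : realType}.
Implicit Types (u v : nat -> R) (c K : R).

Definition oddR (h : nat) : R := (h.*2.+1)%:R.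

Lemma oddRE h : oddR h = 2 * h%:R + 1.
Proof. by rewrite /oddR -natr1 -mul2n natrM. Qed.

Lemma oddR_gt0 h : 0 < oddR h. Proof. by rewrite ltr0n. Qed.

Lemma oddR_ge1 h : 1 <= oddR h. Proof. by rewrite ler1n. Qed.

Lemma cvg_inv_oddR : (oddR h)^-1 @[h --> \oo] --> (0 : R).
Proof.
apply: (@squeeze_cvgr _ _ _ _ (fun=> 0) harmonic) (cvg_cst _) cvg_harmonic.
apply: nearW => h; rewrite invr_ge0 (ltW (oddR_gt0 h))/=.
by rewrite lef_pV2 ?posrE ?oddR_gt0 ?ltr0n// ler_nat; lia.
Qed.

Lemma cvg_oddR_bound u c K : (forall h, `|u h - c| <= K * (oddR h)^-1) ->
  u h @[h --> \oo] --> c.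
Proof.
move=> uc.
have h0 : K * (oddR h)^-1 @[h --> \oo] --> (0 : R).
  by rewrite -(mulr0 K); apply: cvgM; [exact: cvg_cst|exact: cvg_inv_oddR].
have h1 : u h - c @[h --> \oo] --> (0 : R).
  apply/cvgr0Pnorm_le => e e0; move/cvgr0Pnorm_le : h0 => /(_ e e0); apply: filterS => h.
  by move=> He; apply: le_trans (uc h) _; exact: le_trans (ler_norm _) He.
rewrite -[c]add0r; under eq_cvg => h do rewrite -(subrK c (u h)).
by apply: cvgD => //; exact: cvg_cst.
Qed.

Lemma cvg_expR u c : u h @[h --> \oo] --> c -> expR (u h) @[h --> \oo] --> expR c.
Proof. by move=> uc; apply: continuous_cvg => //; exact: continuous_expR. Qed.

Lemma cvg_cos u c : u h @[h --> \oo] --> c -> cos (u h) @[h --> \oo] --> cos c.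
Proof. by move=> uc; apply: continuous_cvg => //; exact: continuous_cos. Qed.

Lemma onem_ge_expR (w : R) : 0 <= w < 1 -> expR (- (w / (1 - w))) <= 1 - w.
Proof.
move=> /andP[w0 w1]; have w1' : 0 < 1 - w by rewrite subr_gt0.
rewrite expRN -[leRHS]invrK lef_pV2 ?posrE ?expR_gt0 ?invr_gt0//.
apply: le_trans (expR_ge1Dx _).
by rewrite le_eqVlt; apply/orP; left; apply/eqP; field; rewrite gt_eqF.
Qed.

(** Squeezed between [expR (- M u / (1 - u))] and [expR (- M u)], without logarithms. *)
Lemma cvg_expn_onem u (M : nat -> nat) c :
  (forall h, 0 <= u h) -> u h @[h --> \oo] --> (0 : R) ->
  (M h)%:R * u h @[h --> \oo] --> c ->
  (1 - u h) ^+ M h @[h --> \oo] --> expR (- c).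
Proof.
move=> u0 uh Mu.
have near1 : \forall h \near \oo, u h < 1 by apply: cvgr_lt uh _ ltr01.
apply: (@squeeze_cvgr _ _ _ _
  (fun h => expR (- ((M h)%:R * u h * (1 - u h)^-1))) (fun h => expR (- ((M h)%:R * u h)))).
- near=> h; have uh1 : u h < 1 by near: h.
  have h1 : 0 < 1 - u h by rewrite subr_gt0.
  have -> : expR (- ((M h)%:R * u h)) = expR (- u h) ^+ M h.
    by rewrite -mulrN mulrC expRM_natr.
  have -> : expR (- ((M h)%:R * u h * (1 - u h)^-1)) = expR (- (u h / (1 - u h))) ^+ M h.
    by rewrite -mulrA -mulrN mulrC expRM_natr.
  apply/andP; split.
    apply: lerXn2r; rewrite ?nnegrE ?expR_ge0 ?(ltW h1)//.
    by apply: onem_ge_expR; rewrite u0.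
  apply: lerXn2r; rewrite ?nnegrE ?expR_ge0 ?(ltW h1)//.
  exact: expR_ge1Dx.
- apply: cvg_expR; apply: cvgN; rewrite -[X in _ --> X]mulr1.
  apply: cvgM => //; rewrite -[X in _ --> X]invr1; apply: cvgV; first exact: oner_neq0.
  by rewrite -[X in _ --> X]subr0; apply: cvgB => //; exact: cvg_cst.
- by apply: cvg_expR; apply: cvgN.
Unshelve. all: by end_near. Qed.

Lemma sin_sqr_le (y : R) : sin y ^+ 2 <= y ^+ 2.
Proof.
wlog y0 : y / 0 <= y => [H|].
  have [/H//|/ltW y0] := leP 0 y.
  by have := H (- y); rewrite sinN !sqrrN oppr_ge0; apply.
have [s0|/ltW s0] := leP 0 (sin y); first by rewrite lerXn2r// sin_le.
rewrite -sqrrN lerXn2r ?nnegrE ?oppr_ge0//.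
have [y1|y1] := leP y 1; last by rewrite (le_trans _ (ltW y1))// lerNl sin_geN1.
have := sin_ge y0; have : 0 <= y * (1 - y ^+ 2 / 6).
  by have y21 := exprn_ile1 2 y0 y1; rewrite mulr_ge0//; lra.
by move: s0 y0; rewrite -[y ^+ 3]/(y * y ^+ 2); lra.
Qed.

Lemma sin_sqr_ge (y : R) : y ^+ 2 - y ^+ 4 / 3 <= sin y ^+ 2.
Proof.
wlog y0 : y / 0 <= y => [H|].
  have [/H//|/ltW y0] := leP 0 y.
  have := H (- y); rewrite sinN sqrrN oppr_ge0 => /(_ y0).
  by rewrite sqrrN (_ : (- y) ^+ 4 = y ^+ 4)//; ring.
have [y6|y6] := leP (y ^+ 2) 6; last first.
  apply: le_trans (sqr_ge0 _); rewrite (_ : _ - _ = y ^+ 2 * (1 - y ^+ 2 / 3)); last by field.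
  by rewrite mulr_ge0_le0 ?sqr_ge0//; lra.
have s0 : 0 <= y - y ^+ 3 / 6.
  rewrite (_ : _ - _ = y * (1 - y ^+ 2 / 6)); last by field.
  by rewrite mulr_ge0//; lra.
apply: le_trans (_ : (y - y ^+ 3 / 6) ^+ 2 <= _); last first.
  by rewrite lerXn2r ?nnegrE ?sin_ge// (le_trans s0)// sin_ge.
rewrite -subr_ge0 (_ : _ - _ = (y ^+ 3 / 6) ^+ 2); last by field.
exact: sqr_ge0.
Qed.

(** The 9 comes from [y - y^3 / 6 >= y / 3], true up to [y = 2]. The range must exceed [pi / 2], the
    limit of the extreme angles in [near_F]. *)
Lemma sin_sqr_ge9 (y : R) : `|y| <= 2 -> y ^+ 2 / 9 <= sin y ^+ 2.
Proof.
wlog y0 : y / 0 <= y => [H|].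
  have [/H//|/ltW y0] := leP 0 y.
  by have := H (- y); rewrite sinN !sqrrN oppr_ge0 normrN; apply.
rewrite ger0_norm// => y2.
have s0 : y / 3 <= y - y ^+ 3 / 6.
  rewrite -subr_ge0 (_ : _ - _ = y * (4 - y ^+ 2) / 6); last by field.
  have y4 : y ^+ 2 <= 2 ^+ 2 by rewrite lerXn2r// nnegrE.
  by rewrite divr_ge0// mulr_ge0//; lra.
rewrite (_ : y ^+ 2 / 9 = (y / 3) ^+ 2); last by field.
have y3 : 0 <= y / 3 by rewrite divr_ge0.
by rewrite lerXn2r ?nnegrE// ?(le_trans _ (sin_ge y0))// (le_trans y3).
Qed.

End Limits.

(** * Poisson summation over the integers as a limit of the finite formula *)

Section Poisson1.
Context {R : realType}.
Variable a : R.
Hypothesis a0 : 0 < a.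

Let l (h : nat) : nat := h.*2.+1.
Let per h : R := oddR h.
(** Chosen so that [cos (pi w / per)^(2 M)], about [expR (- M (pi w / per)^2)], tends to
    [expR (- pi a w^2)]; the successor keeps the exponent positive. *)
Let M (h : nat) : nat := (Num.truncn (a * per h ^+ 2 / pi)).+1.

Let pi0 : 0 < pi :> R := pi_gt0 R.

Let M_bounds h : a * per h ^+ 2 / pi <= (M h)%:R <= a * per h ^+ 2 / pi + 1.
Proof.
have x0 : 0 <= a * per h ^+ 2 / pi by rewrite divr_ge0 ?mulr_ge0 ?sqr_ge0 ?ltW.
have /andP[h1 h2] := truncn_itv x0.
by rewrite (ltW h2)/= /M -natr1 lerD2r.
Qed.

Let per_gt0' h : 0 < per h. Proof. exact: oddR_gt0. Qed.
Let per_neq0 h : per h != 0. Proof. by rewrite gt_eqF. Qed.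
Let pi_neq0 : pi != 0 :> R. Proof. by rewrite gt_eqF. Qed.
Let a_neq0 : a != 0. Proof. by rewrite gt_eqF. Qed.

(* [field] would unfold [pi] and [per h], hence the generalization. *)
Ltac gfield h :=
  let P := fresh in let Q := fresh in let A := fresh in
  let P0 := fresh in let Q0 := fresh in let A0 := fresh in
  move: (per_neq0 h) pi_neq0 a_neq0; move: (per h) (pi : R) (a : R) => P Q A P0 Q0 A0;
  field; rewrite ?P0 ?Q0 ?A0 //.

Let cvg_M : (M h)%:R / per h ^+ 2 @[h --> \oo] --> a / pi.
Proof.
apply: (@cvg_oddR_bound R _ _ 1) => h.
have p1 := oddR_ge1 h : 1 <= per h.
have p2 : 0 < per h ^+ 2 by rewrite exprn_gt0.
have /andP[h1 h2] := M_bounds h.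
have -> : (M h)%:R / per h ^+ 2 - a / pi = ((M h)%:R - a * per h ^+ 2 / pi) / per h ^+ 2.
  gfield h.
rewrite ger0_norm; last by rewrite divr_ge0 ?subr_ge0// ltW.
rewrite ler_pdivrMr// mul1r -/(per h) expr2 mulKf//.
by rewrite lerBlDl (le_trans h2)// lerD2l.
Qed.

Section fixed_parameters.
Variables (x xi t : R).

(** The finite formula accepts only integer frequencies; [p / per] approximates [xi]. *)
Let p (h : nat) : int := Num.floor (xi * per h).

Let cvg_p : (p h)%:~R / per h @[h --> \oo] --> xi.
Proof.
apply: (@cvg_oddR_bound R _ _ 1) => h.
have /andP[h1 h2] := floor_itv (xi * per h).
have -> : (p h)%:~R / per h - xi = ((p h)%:~R - xi * per h) / per h by gfield h.
rewrite normrM normfV (gtr0_norm (per_gt0' h)) -/(per h) ler_pM2r ?invr_gt0//.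
by move: h2; rewrite intrD ler_norml /p => h2; apply/andP; split; lra.
Qed.

Let F (h : nat) (z : int) := if (`|z| <= h)%N then
   cos (pi * (z%:~R + x) / (l h)%:R) ^+ ((M h).*2) *
   cos (2 * pi * (p h)%:~R * (z%:~R + x) / (l h)%:R + t)
   else 0.

Let G (h : nat) (k : int) : R :=
  bratio (M h) (k * (l h)%:Z - p h) * cos (2 * pi * k%:~R * x + t).

Let F_ (z : int) := expR (- (pi * a * (z%:~R + x) ^+ 2)) * cos (2 * pi * xi * (z%:~R + x) + t).

Let G_ (k : int) := expR (- (pi / a * (k%:~R - xi) ^+ 2)) * cos (2 * pi * k%:~R * x + t).

Let cos_exp y m : cos y ^+ m.*2 = (1 - sin y ^+ 2) ^+ m :> R.
Proof. by rewrite -mul2n exprM cos2sin2. Qed.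

Let cvg_F (z : int) : F h z @[h --> \oo] --> F_ z.
Proof.
set w := z%:~R + x.
have near_eq : \forall h \near \oo,
    (1 - sin (pi * w / per h) ^+ 2) ^+ M h * cos (2 * pi * ((p h)%:~R / per h) * w + t) = F h z.
  near=> h; have zh : (`|z| <= h)%N by near: h; exact: nbhs_infty_ge.
  rewrite /F zh -cos_exp; congr (_ * cos (_ + _)).
  by rewrite -/w -[(l h)%:R]/(per h); gfield h.
apply: cvg_trans (near_eq_cvg near_eq) _.
pose y h : R := pi * w / per h.
have y0 : y h @[h --> \oo] --> (0 : R).
  by rewrite -(mulr0 (pi * w)); apply: cvgM; [exact: cvg_cst|exact: cvg_inv_oddR].
have y2 : y h ^+ 2 @[h --> \oo] --> (0 : R).
  by rewrite -(mulr0 (0 : R)); under eq_cvg do rewrite expr2; apply: cvgM.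
have My : (M h)%:R * y h ^+ 2 @[h --> \oo] --> pi * a * w ^+ 2.
  have -> : pi * a * w ^+ 2 = a / pi * (pi * w) ^+ 2 by gfield 0%N.
  have -> : (fun h => (M h)%:R * y h ^+ 2) = (fun h => (M h)%:R / per h ^+ 2 * (pi * w) ^+ 2).
    by apply/funext => h; rewrite /y; gfield h.
  by apply: cvgM; [exact: cvg_M|exact: cvg_cst].
apply: cvgM.
  apply: cvg_expn_onem => [h||]; first exact: sqr_ge0.
    apply: (@squeeze_cvgr _ _ _ _ (fun=> 0) (fun h => y h ^+ 2)) (cvg_cst _) (y2).
    by apply: nearW => h; rewrite sqr_ge0 sin_sqr_le.
  apply: (@squeeze_cvgr _ _ _ _ (fun h => (M h)%:R * y h ^+ 2 * (1 - y h ^+ 2 / 3))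
    (fun h => (M h)%:R * y h ^+ 2)) _ (My).
  - apply: nearW => h; rewrite ler_wpM2l ?sin_sqr_le// andbT -mulrA ler_wpM2l//.
    by apply: le_trans (sin_sqr_ge _); rewrite -/(y h); lra.
  - have h3 : y h ^+ 2 / 3 @[h --> \oo] --> (0 : R).
      by rewrite -(mul0r (3^-1 : R)); apply: cvgM; [exact: y2|exact: cvg_cst].
    have h1 : 1 - y h ^+ 2 / 3 @[h --> \oo] --> (1 : R).
      by rewrite -[X in _ --> X]subr0; apply: cvgB; [exact: cvg_cst|exact: h3].
    by rewrite -[X in _ --> X]mulr1; apply: cvgM; [exact: My|exact: h1].
apply: cvg_cos; apply: cvgD; last exact: cvg_cst.
apply: cvgM; last exact: cvg_cst.
by apply: cvgM => //; exact: cvg_cst.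
Unshelve. all: by end_near. Qed.

Let near_F : \forall h \near \oo, forall z,
  `|F h z| <= expR (- (pi * a / 9 * (z%:~R + x) ^+ 2)).
Proof.
(* For [h >= c] the angle satisfies [pi (h + |x|) / (2 h + 1) <= 2]; this is possible because
   [pi < 4]. *)
pose c := pi * `|x| / (4 - pi).
have pi4 : 0 < 4 - pi :> R by have := @pihalf_lt2 R; lra.
have near_c : \forall h \near \oo, c <= h%:R.
  have [N cN] : exists N : nat, c <= N%:R.
    by exists (Num.truncn c).+1; have [c0|c0] := leP 0 c;
      [have /andP[_ /ltW] := truncn_itv c0|rewrite (le_trans (ltW c0))].
  near=> h; apply: le_trans cN _; rewrite ler_nat; near: h; exact: nbhs_infty_ge.
near=> h => z; have ch : c <= h%:R by near: h.
rewrite /F; case: ifP => zh; last by rewrite normr0 expR_ge0.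
rewrite -[(l h)%:R]/(per h); set y := pi * (z%:~R + x) / per h.
have y2 : `|y| <= 2.
  rewrite /y !normrM normfV (gtr0_norm pi0) (gtr0_norm (per_gt0' h)) ler_pdivrMr//.
  have : `|z%:~R + x| <= h%:R + `|x|.
    rewrite (le_trans (ler_normD _ _))// lerD2r -intr_norm -natr_absz ler_nat//.
  move=> /(ler_wpM2l (ltW pi0)) h1; apply: le_trans h1 _.
  move: ch; rewrite ler_pdivrMr// => ch.
  rewrite /per oddRE; lra.
have cs : 0 <= 1 - sin y ^+ 2 by rewrite -cos2sin2 sqr_ge0.
rewrite normrM cos_exp -[leRHS]mulr1 ler_pM ?cos_max// normrX ger0_norm//.
apply: le_trans (_ : expR (- sin y ^+ 2) ^+ M h <= _).
  by rewrite lerXn2r ?nnegrE ?expR_ge0 ?expR_ge1Dx.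
rewrite -expRM_natr ler_expR mulNr lerN2.
apply: le_trans (_ : y ^+ 2 / 9 * (M h)%:R <= _); last by rewrite ler_wpM2r// sin_sqr_ge9.
have /andP[h1 _] := M_bounds h.
apply: le_trans (ler_wpM2l _ h1); last by rewrite divr_ge0 ?sqr_ge0.
have -> // : pi * a / 9 * (z%:~R + x) ^+ 2 = y ^+ 2 / 9 * (a * per h ^+ 2 / pi).
by rewrite /y; gfield h.
Unshelve. all: by end_near. Qed.

Let A := a / pi + 1.

Let A0 : 0 < A. Proof. by rewrite addr_gt0// divr_gt0. Qed.

Let G_bound h k : `|G h k| <= expR 2^-1 * expR (- ((4 * A)^-1 * (k%:~R + - xi) ^+ 2)).
Proof.
rewrite /G normrM (ger0_norm (bratio_ge0 _ _)) -[leRHS]mulr1 ler_pM ?cos_max ?bratio_ge0//.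
apply: le_trans (bratio_le _ _) _; first by [].
rewrite -expRD ler_expR.
have M0 : 0 < (M h)%:R :> R by rewrite ltr0n.
have M1 : 1 <= (M h)%:R :> R by rewrite ler1n.
have MA : (M h)%:R <= A * per h ^+ 2.
  have /andP[_ h2] := M_bounds h; apply: le_trans h2 _.
  rewrite /A mulrDl mul1r; have -> : a / pi * per h ^+ 2 = a * per h ^+ 2 / pi by gfield h.
  by rewrite lerD2l exprn_ege1// oddR_ge1.
rewrite intrB intrM -[(l h)%:~R]/(per h).
have /andP[f1 f2] := floor_itv (xi * per h).
rewrite -/(p h) intrD in f1 f2.
(* Rounding the frequency shifts the argument by [d], which lies between 0 and 1. It costs half of
   the quadratic term and the factor [expR 2^-1]. *)
set d := xi * per h - (p h)%:~R.
have d1 : d ^+ 2 <= 1 by rewrite exprn_ile1// /d; lra.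
have -> : k%:~R * per h - (p h)%:~R = per h * (k%:~R - xi) + d by rewrite /d; ring.
set u := per h * (k%:~R - xi).
have ud : u ^+ 2 / 2 - 1 <= (u + d) ^+ 2 by have := sqr_ge0 (u + 2 * d); lra.
have h1 : (u ^+ 2 / 2 - 1) / (2 * (M h)%:R) <= (u + d) ^+ 2 / (2 * (M h)%:R).
  by rewrite ler_pM2r// invr_gt0 mulr_gt0.
have h2 : (4 * A)^-1 * (k%:~R + - xi) ^+ 2 <= u ^+ 2 / 2 / (2 * (M h)%:R).
  have h0 : (4 * A)^-1 <= per h ^+ 2 / (4 * (M h)%:R).
    by rewrite ler_pdivlMr ?mulr_gt0// mulrC ler_pdivrMr ?mulr_gt0//; lra.
  apply: le_trans (ler_wpM2r (sqr_ge0 _) h0) _.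
  rewrite /u; move: (per h) (k%:~R - xi) => P w.
  by rewrite le_eqVlt; apply/orP; left; apply/eqP; move: M0; move: (M h)%:R => m m0;
    field; rewrite gt_eqF.
have h3 : (2 * (M h)%:R)^-1 <= 2^-1 :> R.
  by rewrite lef_pV2 ?posrE ?mulr_gt0// ler_peMr.
move: h1; rewrite mulrBl mul1r; lra.
Qed.

Let cvg_G (k : int) : G h k @[h --> \oo] --> G_ k.
Proof.
apply: cvgM; last exact: cvg_cst.
pose i h : int := k * (l h)%:Z - p h.
pose q h : R := (i h)%:~R / per h.
have qE h : q h = k%:~R - (p h)%:~R / per h.
  by rewrite /q /i intrB intrM -[(l h)%:~R]/(per h); gfield h.
have cq : q h @[h --> \oo] --> k%:~R - xi.
  by under eq_cvg do rewrite qE; apply: cvgB; [exact: cvg_cst|exact: cvg_p].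
have cq0 : `|q h| * (per h)^-1 @[h --> \oo] --> (0 : R).
  rewrite -(mulr0 `|k%:~R - xi|); apply: cvgM; last exact: cvg_inv_oddR.
  exact: cvg_norm.
pose mu h : R := (M h)%:R / per h ^+ 2.
have cmu : mu h @[h --> \oo] --> a / pi by exact: cvg_M.
have ap : 0 < a / pi by rewrite divr_gt0.
have cm : mu h - `|q h| * (per h)^-1 @[h --> \oo] --> a / pi.
  by rewrite -[X in _ --> X]subr0; apply: cvgB.
have cp : mu h + `|q h| * (per h)^-1 @[h --> \oo] --> a / pi.
  by rewrite -[X in _ --> X]addr0; apply: cvgD.
have cm0 : \forall h \near \oo, 0 < mu h - `|q h| * (per h)^-1 by apply: cvgr_gt cm _ ap.
have lim (v : nat -> R) : v h @[h --> \oo] --> a / pi ->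
    expR (- (q h ^+ 2 / v h)) @[h --> \oo] --> expR (- (pi / a * (k%:~R - xi) ^+ 2)).
  move=> cv; apply: cvg_expR; apply: cvgN; rewrite mulrC -[pi / a]invf_div.
  apply: cvgM; last by apply: cvgV => //; rewrite gt_eqF.
  by under eq_cvg do rewrite expr2; apply: cvgM.
apply: (@squeeze_cvgr _ _ _ _ (fun h => expR (- (q h ^+ 2 / (mu h - `|q h| * (per h)^-1))))
  (fun h => expR (- (q h ^+ 2 / (mu h + `|q h| * (per h)^-1))))); last first.
- exact: lim.
- exact: lim.
near=> h; have cmh : 0 < mu h - `|q h| * (per h)^-1 by near: h.
have p2 : 0 < per h ^+ 2 by rewrite exprn_gt0.
have iE : `|(i h)%:~R : R| = `|q h| * per h.
  by rewrite /q normrM normfV (gtr0_norm (per_gt0' h)) divfK.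
have mE : mu h - `|q h| * (per h)^-1 = ((M h)%:R - `|(i h)%:~R|) / per h ^+ 2.
  by rewrite iE /mu; move: (q h) => w; gfield h.
have pE : mu h + `|q h| * (per h)^-1 = ((M h)%:R + `|(i h)%:~R|) / per h ^+ 2.
  by rewrite iE /mu; move: (q h) => w; gfield h.
have iM : (`|i h| < M h)%N.
  by move: cmh; rewrite mE pmulr_lgt0 ?invr_gt0// subr_gt0 -intr_norm -natr_absz ltr_nat.
have := @bratio_bounds R _ _ iM.
have e (w : R) : (i h)%:~R ^+ 2 / w = q h ^+ 2 / (w / per h ^+ 2).
  by rewrite /q invf_div; move: ((i h)%:~R : R) (w^-1) => I W; gfield h.
by rewrite !e -mE -pE.
Unshelve. all: by end_near. Qed.

(** Both sides converge separately by dominated convergence. The factors [kappa] are exposed in the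
    statement so that they can be identified across different parameters. *)
Lemma poisson1_limit :
  [/\ summ F_, summ G_ &
     exists kappa : nat -> R, (forall h, kappa h = (l h)%:R * 2 ^- (M h).*2 * 'C((M h).*2, M h)%:R) /\
     exists f g : nat -> R, [/\ f h @[h --> \oo] --> rsum F_,
       g h @[h --> \oo] --> rsum G_ & forall h, f h = kappa h * g h]].
Proof.
have c1 : 0 < pi * a / 9 by rewrite divr_gt0// mulr_gt0.
have c2 : 0 < (4 * A)^-1 by rewrite invr_gt0 mulr_gt0.
have [_ [sF cF]] := cvg_rsum (summ_gauss x c1) near_F cvg_F.
have [_ [sG cG]] := cvg_rsum (summZ (expR 2^-1) (summ_gauss (- xi) c2)) (nearW _ G_bound) cvg_G.
split=> //; eexists; split; first by move=> h; reflexivity.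
exists (fun h => rsum (F h)), (fun h => rsum (G h)); split=> // h.
by have [_ _ ->] := @finite_poisson R (M h) (l h) h (p h) x t erefl.
Qed.

End fixed_parameters.

(* The constant is the limit of the factors of [finite_poisson], which do not
   depend on [x], [xi] and [th]; its value is not needed. *)
Theorem poisson1 : exists2 C : R, 0 < C & forall x xi th : R,
  rsum (fun z : int => expR (- (pi * a * (z%:~R + x) ^+ 2)) *
     cos (2 * pi * (xi * (z%:~R + x) + th))) =
  C * rsum (fun m : int => expR (- (pi / a * (m%:~R - xi) ^+ 2)) *
     cos (2 * pi * (m%:~R * x + th))).
Proof.
have cE (x xi t : R) : cos (2 * pi * (xi * x + t)) = cos (2 * pi * xi * x + 2 * pi * t).
  by rewrite mulrDr mulrA.
have [sF0 sG0 [kap [kapE [f0 [g0 [cf0 cg0 fg0]]]]]] := poisson1_limit 0 0 0.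
set S := rsum _ in cf0; set T := rsum _ in cg0.
have e0 (y : R) : cos (2 * pi * 0 * y + 0) = 1 by rewrite !(mulr0, mul0r) addr0 cos0.
have e1 (y : R) : cos (2 * pi * y * 0 + 0) = 1 by rewrite !(mulr0, mul0r) addr0 cos0.
have S0 : 0 < S.
  apply: (@rsum_gt0 _ _ _ 0) => // [z|].
    by rewrite e0 mulr1 expR_ge0.
  by rewrite e0 mulr1 expR_gt0.
have T0 : 0 < T.
  apply: (@rsum_gt0 _ _ _ 0) => // [z|].
    by rewrite e1 mulr1 expR_ge0.
  by rewrite e1 mulr1 expR_gt0.
exists (S / T); first by rewrite divr_gt0.
(* With all parameters 0 every term is positive, hence [T > 0], and the quotient of the two limits
   gives the limit of [kap]. *)
have ck : kap h @[h --> \oo] --> S / T.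
  have g0n : \forall h \near \oo, 0 < g0 h by apply: cvgr_gt cg0 _ T0.
  have near_eq : \forall h \near \oo, f0 h / g0 h = kap h.
    by apply: filterS g0n => h gh; rewrite fg0 mulfK// gt_eqF.
  apply: cvg_trans (near_eq_cvg near_eq) _.
  by apply: cvgM => //; apply: cvgV => //; rewrite gt_eqF.
move=> x xi th.
have [sF sG [kap' [kapE' [f [g [cf cg fg]]]]]] := poisson1_limit x xi (2 * pi * th).
have kk : kap' = kap by apply/funext => h; rewrite kapE kapE'.
have cf' : f h @[h --> \oo] --> S / T * rsum (fun k : int =>
    expR (- (pi / a * (k%:~R - xi) ^+ 2)) * cos (2 * pi * k%:~R * x + 2 * pi * th)).
  have -> : f = (fun h => kap h * g h) by apply/funext => h; rewrite fg kk.
  exact: cvgM ck cg.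
have e := cvg_unique (@Rhausdorff R) cf cf'.
transitivity (rsum (fun z : int => expR (- (pi * a * (z%:~R + x) ^+ 2)) *
  cos (2 * pi * xi * (z%:~R + x) + 2 * pi * th))).
  by apply: eq_rsum => z; rewrite cE.
by rewrite [LHS]e; congr (_ * _); apply: eq_rsum => m; rewrite cE.
Qed.

End Poisson1.

(** * Poisson summation for positive definite quadratic forms *)

Section QuadraticForms.
Context {R : realType}.

Definition quad n (G : 'M[R]_n) (y : 'rV[R]_n) : R := (y *m G *m y^T) 0 0.

Definition posdef n (G : 'M[R]_n) := G^T = G /\ forall y, y != 0 -> 0 < quad G y.

Definition zvec n (z : 'rV[int]_n) : 'rV[R]_n := map_mx intr z.

Lemma dotpE n (u v : 'rV[R]_n) : dotp u v = (u *m v^T) 0 0.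
Proof. by rewrite /dotp mxE; apply: eq_bigr => i _; rewrite mxE. Qed.

Lemma dotpC n (u v : 'rV[R]_n) : dotp u v = dotp v u.
Proof. by apply: eq_bigr => i _; rewrite mulrC. Qed.

Lemma dotpDl n (u v w : 'rV[R]_n) : dotp (u + v) w = dotp u w + dotp v w.
Proof. by rewrite /dotp -big_split; apply: eq_bigr => i _; rewrite mxE mulrDl. Qed.

Lemma dotpZl n c (u w : 'rV[R]_n) : dotp (c *: u) w = c * dotp u w.
Proof. by rewrite /dotp mulr_sumr; apply: eq_bigr => i _; rewrite mxE mulrA. Qed.

Lemma dotpNl n (u w : 'rV[R]_n) : dotp (- u) w = - dotp u w.
Proof. by rewrite -scaleN1r dotpZl mulN1r. Qed.

Lemma dotpBl n (u v w : 'rV[R]_n) : dotp (u - v) w = dotp u w - dotp v w.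
Proof. by rewrite dotpDl dotpNl. Qed.

Lemma dotpDr n (u v w : 'rV[R]_n) : dotp w (u + v) = dotp w u + dotp w v.
Proof. by rewrite dotpC dotpDl !(dotpC w). Qed.

Lemma dotpZr n c (u w : 'rV[R]_n) : dotp w (c *: u) = c * dotp w u.
Proof. by rewrite dotpC dotpZl dotpC. Qed.

Lemma dotpNr n (u w : 'rV[R]_n) : dotp w (- u) = - dotp w u.
Proof. by rewrite dotpC dotpNl dotpC. Qed.

Lemma dotp0l n (w : 'rV[R]_n) : dotp 0 w = 0.
Proof. by rewrite -(scale0r (0 : 'rV[R]_n)) dotpZl mul0r. Qed.

Lemma dotp_row n (u v : R) (y w : 'rV[R]_n) :
  dotp (row_mx u%:M y : 'rV[R]_(1 + n)) (row_mx v%:M w) = u * v + dotp y w.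
Proof.
rewrite /dotp big_split_ord big_ord1 /= !row_mxEl !mxE eqxx !mulr1n; congr (_ + _).
by apply: eq_bigr => i _; rewrite !row_mxEr.
Qed.

Section Schur.
Variables (n : nat) (G : 'M[R]_(1 + n)).
Hypothesis pG : posdef G.

Let al := G 0 0.
Let b : 'rV[R]_n := ursubmx G.

Definition schur_coef : 'rV[R]_n := al^-1 *: b.
Definition schur : 'M[R]_n := drsubmx G - al^-1 *: (b^T *m b).

Lemma G_block : G = block_mx al%:M b b^T (drsubmx G).
Proof.
rewrite -[LHS]submxK; congr block_mx.
  apply/matrixP => i j; rewrite !ord1 !mxE eqxx mulr1n /al.
  by congr (G _ _); apply/val_inj.
by rewrite /b trmx_ursub pG.1.
Qed.

Lemma mul_bT (y : 'rV[R]_n) : y *m b^T = (dotp b y)%:M.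
Proof. by apply/matrixP => i j; rewrite !ord1 -dotpE dotpC [RHS]mxE eqxx mulr1n. Qed.

Lemma quad_row u (y : 'rV[R]_n) :
  quad G (row_mx u%:M y) = al * u ^+ 2 + 2 * u * dotp b y + quad (drsubmx G) y.
Proof.
rewrite /quad {1}G_block tr_row_mx mul_row_block mul_row_col tr_scalar_mx.
rewrite !mulmxDl !mul_scalar_mx !mul_mx_scalar -!scalemxAl.
rewrite mxE [X in X + _ = _]mxE [X in _ + X = _]mxE.
have Z c (A : 'M[R]_1) : (c *: A) 0 0 = c * A 0 0 by rewrite mxE.
rewrite !Z -!dotpE (dotpC y) -/(quad _ _) [al%:M 0 0]mxE eqxx mulr1n; ring.
Qed.

Lemma mul_row_G u (y : 'rV[R]_n) :
  row_mx u%:M y *m G = row_mx (al * u + dotp b y)%:M (u *: b + y *m drsubmx G).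
Proof.
rewrite {1}G_block mul_row_block !mul_scalar_mx; congr row_mx.
apply/matrixP => i j; rewrite !ord1 mxE [X in X + _ = _]mxE.
by rewrite -dotpE (dotpC y) !mxE eqxx !mulr1n mulrC.
Qed.

Lemma schur_coef_gt0 : 0 < al.
Proof.
have := pG.2 (row_mx 1%:M 0); rewrite quad_row => /(_ _).
rewrite (_ : quad _ 0 = 0); last by rewrite /quad mul0mx mul0mx mxE.
rewrite dotpC dotp0l expr1n mulr1 mulr0 !addr0; apply.
apply/eqP => /matrixP /(_ 0 (lshift n 0)); rewrite row_mxEl !mxE => /eqP.
by rewrite mulr1n oner_eq0.
Qed.

Lemma quad_schur u (y : 'rV[R]_n) :
  quad G (row_mx u%:M y) = al * (u + dotp schur_coef y) ^+ 2 + quad schur y.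
Proof.
have al0 : al != 0 by rewrite gt_eqF// schur_coef_gt0.
have -> : quad schur y = quad (drsubmx G) y - al^-1 * dotp b y ^+ 2.
  rewrite /quad /schur mulmxBr mulmxBl mxE; congr (_ + _).
  rewrite mxE -scalemxAr -scalemxAl mxE; congr (- (_ * _)).
  have -> : y *m (b^T *m b) = dotp b y *: b.
    by rewrite mulmxA mul_bT mul_scalar_mx.
  by rewrite -scalemxAl mxE -dotpE expr2.
by rewrite quad_row dotpZl; field.
Qed.

Lemma schur_posdef : posdef schur.
Proof.
split.
  rewrite /schur linearB linearZ /= trmx_mul trmxK; congr (_ - _).
  by rewrite trmx_drsub pG.1.
(* This first coordinate makes the completed square vanish. *)
move=> y y0; have := pG.2 (row_mx (- dotp schur_coef y)%:M y).
rewrite quad_schur addNr expr0n mulr0 add0r; apply.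
apply: contra y0 => /eqP /(congr1 rsubmx); rewrite row_mxKr => ->.
by apply/eqP/matrixP => i j; rewrite !mxE.
Qed.

(** Subtracting the first block times [schur_coef] from the second leaves [y *m schur]. This is the
    shape in which the dual form of the induction step is evaluated. *)
Lemma mul_row_schur u (y : 'rV[R]_n) :
  row_mx u%:M y *m G =
    row_mx (al * (u + dotp schur_coef y))%:M
      (al * (u + dotp schur_coef y) *: schur_coef + y *m schur).
Proof.
rewrite mul_row_G dotpZl.
have al0 : al != 0 by rewrite gt_eqF// schur_coef_gt0.
congr row_mx; first by congr (_%:M); field.
rewrite /schur /schur_coef mulmxBr scalerA -scalemxAr mulmxA.
have -> : al * (u + al^-1 * dotp b y) * al^-1 = u + al^-1 * dotp b y by field.
by rewrite mul_bT mul_scalar_mx scalerA scalerDl -addrA [_ *: b + (_ - _)]addrC subrK.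
Qed.

End Schur.
End QuadraticForms.

Section MorePairSums.
Context {R : realType}.

Lemma summ_mul {T T' : choiceType} (f : T -> R) (g : T' -> R) : summ f -> summ g ->
  summ (fun p : T * T' => f p.1 * g p.2).
Proof.
move=> sf sg; apply: (@summ_pair _ _ _ _ (fun i => `|f i| * rsum (fun j => `|g j|))).
- by move=> i; exact: (summZ (f i) sg).
- move=> i /=; under eq_rsum do rewrite normrM.
  by rewrite rsumZ//; exact: summ_norm.
- exact: (summZr _ (summ_norm sf)).
Qed.

End MorePairSums.

(** * Induction on the dimension *)

Section PoissonN.
Context {R : realType}.

(** [rsum_pair] sums over the second component first, and the two sides of [poisson] need opposite
    orders; hence this map and [row_rcons]. *)
Definition row_cons n (p : int * 'rV[int]_n) : 'rV[int]_(1 + n) := row_mx p.1%:M p.2.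
Definition row_rcons n (p : 'rV[int]_n * int) : 'rV[int]_(1 + n) := row_mx p.2%:M p.1.

Lemma row_rcons_bij n : bijective (@row_rcons n).
Proof.
exists (fun z : 'rV[int]_(1 + n) => (rsubmx z, lsubmx z 0 0)) => [[y u]|z].
  by rewrite /row_rcons/= row_mxKr row_mxKl mxE eqxx mulr1n.
rewrite /row_rcons/= -[RHS]hsubmxK; congr row_mx.
by apply/matrixP => i j; rewrite !ord1 [LHS]mxE eqxx mulr1n.
Qed.

Lemma row_cons_bij n : bijective (@row_cons n).
Proof.
exists (fun z : 'rV[int]_(1 + n) => (lsubmx z 0 0, rsubmx z)) => [[u y]|z].
  by rewrite /row_cons/= row_mxKr row_mxKl mxE eqxx mulr1n.
rewrite /row_cons/= -[RHS]hsubmxK; congr row_mx.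
by apply/matrixP => i j; rewrite !ord1 [LHS]mxE eqxx mulr1n.
Qed.

Lemma zvec_row n (k : int) (z : 'rV[int]_n) :
  zvec (row_mx k%:M z : 'rV[int]_(1 + n)) = row_mx k%:~R%:M (zvec z) :> 'rV[R]_(1 + n).
Proof. by rewrite /zvec map_row_mx map_scalar_mx. Qed.

(** [Q] is a function and not a matrix, because the induction builds the dual form as a function. *)
Definition gaussz n (Q : 'rV[R]_n -> R) (x : 'rV[R]_n) (z : 'rV[int]_n) : R :=
  expR (- (pi * Q (zvec z + x))).

Lemma gaussz_ge0 n (Q : 'rV[R]_n -> R) x z : 0 <= gaussz Q x z.
Proof. exact: expR_ge0. Qed.

Lemma le_gauss_cos (u v : R) : 0 <= u -> `|u * cos v| <= u.
Proof. by move=> u0; rewrite normrM ger0_norm// ler_piMr// cos_max. Qed.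

(* [Qs] is the dual form, determined by its values on the image of [G]. By
   induction on [n]: completing the square in the first coordinate reduces to
   [poisson1] and to the Schur complement, and the dual forms combine likewise.
   The induction needs the shift [x] together with the character [xi]. *)
Theorem poisson n (G : 'M[R]_n) : posdef G ->
  exists (C : R) (Qs : 'rV[R]_n -> R),
  [/\ 0 < C, forall z, Qs (z *m G) = quad G z,
      forall x, summ (gaussz (quad G) x),
      forall xi, summ (gaussz Qs (- xi)) &
      forall x xi th,
        rsum (fun z => gaussz (quad G) x z * cos (2 * pi * (dotp xi (zvec z + x) + th))) =
        C * rsum (fun m => gaussz Qs (- xi) m * cos (2 * pi * (dotp (zvec m) x + th)))].
Proof.
elim: n G => [|n IH] G pG.
  have all0 (z : 'rV[R]_0) : z = 0 by apply/matrixP => i [].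
  have allz (z : 'rV[int]_0) : z = 0 by apply/matrixP => i [].
  have s1 (f : 'rV[int]_0 -> R) : summ f /\ rsum f = f 0.
    have f0 i : i \notin [:: (0 : 'rV[int]_0)] -> f i = 0.
      by rewrite (allz i) inE eqxx.
    by have [sf ->] := rsum_seq (s := [:: 0]) isT f0; rewrite big_seq1.
  exists 1, (quad G); split=> // [z|x|x|x xi th].
  - by congr quad; rewrite (all0 z) mul0mx.
  - exact: (s1 _).1.
  - exact: (s1 _).1.
  - rewrite !(s1 _).2 mul1r /gaussz (all0 (_ + - xi)) (all0 (_ + x)).
    by rewrite (all0 xi) (all0 (zvec 0)) !dotp0l.
rewrite -[n.+1]/(1 + n)%N in G pG *.
pose al := G 0 0; have al0 : 0 < al by exact: schur_coef_gt0.
pose be := schur_coef G.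
have [C' [Qs' [C'0 Qs'E sQ sQs' pois']]] := IH _ (schur_posdef pG).
have [C1 C10 pois1] := poisson1 al0.
pose Q' := quad (schur G).
have pal0 : 0 < pi / al by rewrite divr_gt0 ?pi_gt0.
have pia0 : 0 < pi * al by rewrite mulr_gt0 ?pi_gt0.
pose T1 := rsum (fun m : int => expR (- (pi / al * (m%:~R + 0) ^+ 2)) : R).
(* The bound has to be uniform in [v], which varies with the other coordinates. On the dual side of
   [poisson1] the shift occurs only inside the cosine. *)
have bound1 v : rsum (fun k : int => expR (- (pi * al * (k%:~R + v) ^+ 2))) <= C1 * T1.
  have := pois1 v 0 0.
  under eq_rsum => k do rewrite mul0r addr0 mulr0 cos0 mulr1.
  move=> ->; rewrite ler_pM2l//; apply: ler_rsum.
  - apply: summ_le (summ_gauss 0 pal0) => k; rewrite subr0 !addr0.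
    by rewrite le_gauss_cos ?expR_ge0.
  - exact: summ_gauss.
  - move=> k; rewrite subr0 !addr0 (le_trans (ler_norm _))//.
    by rewrite le_gauss_cos ?expR_ge0.
pose T' := rsum (gaussz Q' 0).
have bound' xi : rsum (gaussz Qs' (- xi)) <= C'^-1 * T'.
  have := pois' 0 xi 0.
  under [X in _ = _ * X]eq_rsum => k do rewrite dotpC dotp0l addr0 mulr0 cos0 mulr1.
  move=> e; rewrite ler_pdivlMl// -e; apply: ler_rsum => //.
  - by apply: summ_le (sQ 0) => z; rewrite le_gauss_cos ?gaussz_ge0.
  - by move=> z; rewrite (le_trans (ler_norm _))// le_gauss_cos ?gaussz_ge0.
pose Qs (m : 'rV[R]_(1 + n)) : R :=
  lsubmx m 0 0 ^+ 2 / al + Qs' (rsubmx m - lsubmx m 0 0 *: be).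
have QsE u (y : 'rV[R]_n) : Qs (row_mx u%:M y) = u ^+ 2 / al + Qs' (y - u *: be).
  by rewrite /Qs row_mxKl row_mxKr mxE eqxx mulr1n.
have split_row (x : 'rV[R]_(1 + n)) : x = row_mx (lsubmx x 0 0)%:M (rsubmx x).
  rewrite -[LHS]hsubmxK; congr row_mx.
  by apply/matrixP => i j; rewrite !ord1 [RHS]mxE eqxx mulr1n.
have addE (k : int) (z : 'rV[int]_n) u (y : 'rV[R]_n) :
    zvec (row_mx k%:M z : 'rV[int]_(1 + n)) + row_mx u%:M y =
    row_mx (k%:~R + u)%:M (zvec z + y).
  by rewrite zvec_row add_row_mx raddfD.
have gE x (z : 'rV[int]_n) k : gaussz (quad G) x (row_rcons (z, k)) =
    gaussz Q' (rsubmx x) z *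
    expR (- (pi * al * (k%:~R + (lsubmx x 0 0 + dotp be (zvec z + rsubmx x))) ^+ 2)).
  rewrite /gaussz {1}(split_row x) /row_rcons addE quad_schur// -expRD; congr expR.
  rewrite -/al -/be /Q'; ring.
have hE xi (m : 'rV[int]_n) k : gaussz Qs (- xi) (row_cons (k, m)) =
    expR (- (pi / al * (k%:~R - lsubmx xi 0 0) ^+ 2)) *
    gaussz Qs' (- (rsubmx xi + (k%:~R - lsubmx xi 0 0) *: be)) m.
  rewrite /gaussz {1}(split_row xi) /row_cons opp_row_mx -raddfN addE QsE -expRD; congr expR.
  rewrite opprD !addrA; ring.
have sG x : summ (gaussz (quad G) x).
  rewrite (summ_bij _ (row_rcons_bij n)).
  apply: (@summ_pair _ _ _ _ (fun z => gaussz Q' (rsubmx x) z * (C1 * T1))).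
  - move=> z; under [X in summ X]eq_fun do rewrite gE.
    by apply: summZ; exact: summ_gauss.
  - move=> z; under eq_rsum do rewrite gE ger0_norm ?mulr_ge0 ?expR_ge0//.
    rewrite rsumZ; last exact: summ_gauss.
    by rewrite ler_wpM2l ?gaussz_ge0.
  - by apply: summZr; exact: sQ.
have sQs xi : summ (gaussz Qs (- xi)).
  rewrite (summ_bij _ (row_cons_bij n)).
  apply: (@summ_pair _ _ _ _
    (fun k => expR (- (pi / al * (k%:~R - lsubmx xi 0 0) ^+ 2)) * (C'^-1 * T'))).
  - move=> k; under [X in summ X]eq_fun do rewrite hE.
    by apply: summZ; exact: sQs'.
  - move=> k; under eq_rsum do rewrite hE ger0_norm ?mulr_ge0 ?expR_ge0//.
    rewrite rsumZ; last exact: sQs'.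
    by rewrite ler_wpM2l ?expR_ge0.
  - by apply: summZr; exact: summ_gauss.
exists (C1 * C'), Qs; split=> //; first exact: mulr_gt0.
  move=> z; rewrite (split_row z); rewrite (mul_row_schur pG).
  rewrite QsE quad_schur// -/al -/be [_ + _ *m schur G]addrC addrK Qs'E.
  by congr (_ + _); field; rewrite gt_eqF.
move=> x xi th.
set x0 := lsubmx x 0 0; set x' := rsubmx x; set k0 := lsubmx xi 0 0; set xi' := rsubmx xi.
(* The mixed double sum, with the first coordinate already on the dual side and the others not yet.
   Both sides of the goal reduce to it. *)
pose f (z : 'rV[int]_n) (m : int) := gaussz Q' x' z *
   (expR (- (pi / al * (m%:~R - k0) ^+ 2)) *
    cos (2 * pi * (dotp (xi' + (m%:~R - k0) *: be) (zvec z + x') + (m%:~R * x0 + th)))).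
have sf : summ (fun p => f p.1 p.2).
  apply: summ_le (summ_mul (sQ x') (summ_gauss (- k0) pal0)) => -[z m] /=.
  rewrite /f mulrA le_gauss_cos// mulr_ge0 ?expR_ge0//.
have sF : summ (fun z => gaussz (quad G) x z * cos (2 * pi * (dotp xi (zvec z + x) + th))).
  by apply: summ_le (sG x) => z; rewrite le_gauss_cos ?gaussz_ge0.
have sH : summ (fun m => gaussz Qs (- xi) m * cos (2 * pi * (dotp (zvec m) x + th))).
  by apply: summ_le (sQs xi) => z; rewrite le_gauss_cos ?gaussz_ge0.
pose FL z := gaussz (quad G) x z * cos (2 * pi * (dotp xi (zvec z + x) + th)).
pose FR m := gaussz Qs (- xi) m * cos (2 * pi * (dotp (zvec m) x + th)).
have sF' : summ (fun p => FL (row_rcons p)) by rewrite -(summ_bij FL (row_rcons_bij n)).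
have sH' : summ (fun p => FR (row_cons p)) by rewrite -(summ_bij FR (row_cons_bij n)).
transitivity (C1 * rsum (fun z => rsum (f z))).
  rewrite -/FL (rsum_bij FL (row_rcons_bij n)) (rsum_pair sF').
  rewrite -rsumZ; last exact: (summ_rsum sf).
  apply: eq_rsum => z; rewrite /FL.
  under eq_rsum => k do rewrite gE -mulrA.
  rewrite rsumZ; last first.
    apply: summ_le (summ_gauss (x0 + dotp be (zvec z + x')) pia0) => k.
    by rewrite le_gauss_cos ?expR_ge0.
  rewrite /f rsumZ; last first.
    apply: summ_le (summ_gauss (- k0) pal0) => k.
    by rewrite le_gauss_cos ?expR_ge0.
  rewrite mulrCA; congr (_ * _).
  rewrite -/x0 -/x'; set y := zvec z + x'; set v := x0 + dotp be y.
  transitivity (C1 * rsum (fun m : int => expR (- (pi / al * (m%:~R - k0) ^+ 2)) *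
     cos (2 * pi * (m%:~R * v + (dotp xi' y - k0 * dotp be y + th))))).
    rewrite -pois1; apply: eq_rsum => k; congr (_ * cos (_ * _)).
    rewrite {1}(split_row x) {1}(split_row xi) /row_rcons addE dotp_row.
    rewrite -/x0 -/x' -/k0 -/xi' -/y /v; ring.
  congr (_ * _); apply: eq_rsum => m; congr (_ * cos (_ * _)).
  rewrite dotpDl (dotpZl (_ - _) be) /v; ring.
rewrite (rsum_exchange sf) -mulrA; congr (_ * _).
rewrite -/FR (rsum_bij FR (row_cons_bij n)) (rsum_pair sH').
rewrite -rsumZ; last exact: (summ_rsum sH').
apply: eq_rsum => m; rewrite /FR.
under [in X in _ = X]eq_rsum => k do rewrite hE -mulrA.
rewrite rsumZ; last first.
  apply: summ_le (sQs' (rsubmx xi + (m%:~R - lsubmx xi 0 0) *: be)) => k.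
  by rewrite le_gauss_cos ?gaussz_ge0.
rewrite mulrCA.
under eq_rsum => z do rewrite /f mulrCA.
rewrite rsumZ; last first.
  apply: summ_le (sQ x') => z; rewrite le_gauss_cos ?gaussz_ge0//.
congr (_ * _); rewrite pois'; congr (_ * _); apply: eq_rsum => k; congr (_ * cos (_ * _)).
rewrite [in RHS](split_row x) zvec_row dotp_row -/x0 -/x'; ring.
Qed.

End PoissonN.

(** * The discrete Gaussian on a lattice *)

Section LatticeGaussian.
Context {R : realType}.
Variables (n : nat) (B : 'M[R]_n) (s : R).
Hypotheses (freeB : row_free B) (s0 : 0 < s).
Implicit Types (u v y : 'rV[R]_n).

Definition lpoint (z : 'rV[int]_n) : 'rV[R]_n := zvec z *m B.

Lemma B_unit : B \in unitmx. Proof. by rewrite -row_free_unit. Qed.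

Lemma dotp_ge0 m (u : 'rV[R]_m) : 0 <= dotp u u.
Proof. by apply: sumr_ge0 => i _; rewrite -expr2 sqr_ge0. Qed.

Lemma enorm_sqr m (u : 'rV[R]_m) : enorm u ^+ 2 = dotp u u.
Proof. by rewrite sqr_sqrtr// dotp_ge0. Qed.

Lemma dotp_eq0 m (u : 'rV[R]_m) : dotp u u = 0 -> u = 0.
Proof.
move=> /eqP; rewrite psumr_eq0 => [/allP h|i _]; last by rewrite -expr2 sqr_ge0.
apply/matrixP => i j; rewrite ord1 mxE; apply/eqP.
by have := h j (mem_index_enum j); rewrite /= mulf_eq0 orbb.
Qed.

Lemma rhoE m (x : R) (u : 'rV[R]_m) : rho x u = expR (- (pi * dotp u u / x ^+ 2)).
Proof. by rewrite /rho enorm_sqr. Qed.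

Lemma lpoint_inj : injective lpoint.
Proof.
move=> z1 z2 /(can_inj (mulmxK B_unit)) /matrixP h; apply/matrixP => i j.
by have := h i j; rewrite !mxE => /intr_inj.
Qed.

Lemma lattice_image : lattice_of B = lpoint @` setT.
Proof.
apply/seteqP; split=> y.
  by move=> [z ->]; exists z.
by move=> [z _ <-]; exists z.
Qed.

Lemma esum_lattice (f : 'rV[R]_n -> R) :
  (\esum_(y in lattice_of B) (f y)%:E)%E = nsum (fun z => f (lpoint z)).
Proof. by rewrite lattice_image esum_image// => z1 z2 _ _; exact: lpoint_inj. Qed.

Definition dpoint (m : 'rV[int]_n) : 'rV[R]_n := zvec m *m (invmx B)^T.

Lemma dpoint_inj : injective dpoint.
Proof.
have u : (invmx B)^T \in unitmx by rewrite unitmx_tr unitmx_inv B_unit.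
move=> z1 z2 /(can_inj (mulmxK u)) /matrixP h; apply/matrixP => i j.
by have := h i j; rewrite !mxE => /intr_inj.
Qed.

Lemma dual_image : dual (lattice_of B) = dpoint @` setT.
Proof.
have tB : B^T *m (invmx B)^T = 1%:M.
  by rewrite -trmx_mul mulVmx ?trmx1// B_unit.
have tB' : (invmx B)^T *m B^T = 1%:M.
  by rewrite -trmx_mul mulmxV ?trmx1// B_unit.
apply/seteqP; split=> [w wd|w [m _ <-] y [z ->]].
  pose m : 'rV[int]_n := \row_j Num.floor (dotp w (row j B)).
  exists m => //; rewrite /dpoint.
  have -> : zvec m = w *m B^T.
    apply/matrixP => i j; rewrite !mxE.
    have /wd : lattice_of B (row j B).
      exists (delta_mx 0 j); rewrite rowE; congr (_ *m _).
      by apply/matrixP => k l; rewrite !mxE; case: (_ && _).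
    rewrite intrEfloor => /eqP ->; rewrite ord1 dotpE mxE.
    by apply: eq_bigr => k _; rewrite !mxE.
  by rewrite -mulmxA tB mulmx1.
rewrite dotpE /dpoint trmx_mul -mulmxA (mulmxA _ B^T) tB' mul1mx mxE.
by rewrite rpred_sum// => i _; rewrite !mxE rpredM// intr_int.
Qed.

Definition lgram : 'M[R]_n := (s ^+ 2)^-1 *: (B *m B^T).

Lemma quad_lgram y : quad lgram y = dotp (y *m B) (y *m B) / s ^+ 2.
Proof.
rewrite /quad /lgram dotpE trmx_mul -scalemxAr -scalemxAl mxE mulrC.
by rewrite !mulmxA.
Qed.

Lemma lgram_posdef : posdef lgram.
Proof.
split; first by rewrite /lgram linearZ/= trmx_mul trmxK.
move=> y y0; rewrite quad_lgram divr_gt0 ?exprn_gt0// lt_neqAle dotp_ge0 andbT eq_sym.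
apply: contra y0 => /eqP/dotp_eq0 yB.
by rewrite -[y](mulmxK B_unit) yB mul0mx.
Qed.

Lemma gaussz_lgram x z : gaussz (quad lgram) x z = rho s (lpoint z + x *m B).
Proof. by rewrite /gaussz quad_lgram rhoE mulmxDl mulrA. Qed.

Hypothesis smooth : rho_set s^-1 (dual (lattice_of B)) = (3 / 2)%:E.

(* By Poisson summation the shifted Gaussian sum is proportional to a cosine
   series over the dual lattice, whose nonzero terms sum to at most 1/2 in
   absolute value against a constant term 1. *)
Lemma lattice_gauss_bounds : exists2 S : R, 0 < S &
  [/\ rsum (fun z => rho s (lpoint z)) = S &
   forall v, [/\ summ (fun z => rho s (lpoint z - v)),
     S / 3 <= rsum (fun z => rho s (lpoint z - v)) &
     rsum (fun z => rho s (lpoint z - v)) <= S]].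
Proof.
have sn : s != 0 by rewrite gt_eqF.
have [C [Qs [C0 QsE sQ sQs pois]]] := poisson lgram_posdef.
have gQ m : gaussz Qs (- 0) m = rho s^-1 (dpoint m).
  have tBu : B^T \in unitmx by rewrite unitmx_tr B_unit.
  (* This [y] satisfies [y *m lgram = zvec m], a point where [Qs] is known. *)
  pose y := s ^+ 2 *: (dpoint m *m invmx B).
  have -> : gaussz Qs (- 0) m = expR (- (pi * Qs (y *m lgram))).
    rewrite /gaussz oppr0 addr0; congr (expR (- (_ * Qs _))).
    rewrite /y /lgram -scalemxAl -scalemxAr scalerA divff ?expf_neq0// scale1r.
    rewrite mulmxA mulmxKV ?B_unit// /dpoint -mulmxA -trmx_mul mulmxV ?B_unit//.
    by rewrite trmx1 mulmx1.
  rewrite QsE quad_lgram rhoE /y -scalemxAl mulmxKV ?B_unit// dotpZl dotpZr.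
  congr (expR (- _)); field; exact: sn.
have sumg : summ (fun m => gaussz Qs (- 0) m) by exact: sQs.
have rg : rsum (fun m => gaussz Qs (- 0) m) = 3 / 2.
  apply: EFin_inj; rewrite rsumE//; last by move=> m; exact: gaussz_ge0.
  rewrite -smooth /rho_set dual_image esum_image; last by move=> ? ? _ _; exact: dpoint_inj.
  by apply: eq_esum => m _; rewrite gQ.
have g0 : gaussz Qs (- 0) 0 = 1.
  rewrite gQ rhoE /dpoint (_ : zvec 0 = 0); last by apply/matrixP => i j; rewrite !mxE.
  by rewrite mul0mx dotp0l mulr0 mul0r oppr0 expR0.
pose c x (m : 'rV[int]_n) := cos (2 * pi * (dotp (zvec m) x + 0)) : R.
have poisE x : rsum (fun z => rho s (lpoint z + x *m B)) =
    C * rsum (fun m => gaussz Qs (- 0) m * c x m).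
  rewrite -(pois x 0 0); apply: eq_rsum => z.
  by rewrite dotp0l addr0 mulr0 cos0 mulr1 gaussz_lgram.
have sc x : summ (fun m => gaussz Qs (- 0) m * c x m).
  by apply: summ_le sumg => m; rewrite le_gauss_cos ?gaussz_ge0.
have up x : rsum (fun m => gaussz Qs (- 0) m * c x m) <= 3 / 2.
  rewrite -rg; apply: ler_rsum => // m; rewrite (le_trans (ler_norm _))//.
  by rewrite le_gauss_cos ?gaussz_ge0.
(* Adding the weights makes every term nonnegative. The term at 0 alone then contributes 2, and
   removing the total weight 3/2 leaves 1/2. *)
have lo x : 1 / 2 <= rsum (fun m => gaussz Qs (- 0) m * c x m).
  have : gaussz Qs (- 0) 0 * c x 0 + gaussz Qs (- 0) 0 <=
      rsum (fun m => gaussz Qs (- 0) m * c x m + gaussz Qs (- 0) m).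
    have := @sum_seq_le_rsum _ _ (fun m => gaussz Qs (- 0) m * c x m + gaussz Qs (- 0) m) [:: 0].
    rewrite big_seq1; apply => // [m|]; last exact: summD.
    rewrite -[X in _ + X]mulr1 -mulrDr mulr_ge0 ?gaussz_ge0//.
    by rewrite -lerBlDr sub0r cos_geN1.
  rewrite rsumD// rg g0 /c (_ : zvec 0 = 0); last by apply/matrixP => i j; rewrite !mxE.
  by rewrite dotp0l addr0 mulr0 cos0 mul1r; lra.
have r0 : rsum (fun z => rho s (lpoint z)) = C * (3 / 2).
  have := poisE 0; under eq_rsum do rewrite mul0mx addr0.
  move=> ->; congr (_ * _); rewrite -rg; apply: eq_rsum => m.
  by rewrite /c dotpC dotp0l addr0 mulr0 cos0 mulr1.
exists (C * (3 / 2)); first by rewrite mulr_gt0.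
split=> // v.
have vE : - v = (- v *m invmx B) *m B by rewrite mulmxKV ?B_unit.
split.
- apply: eq_summ (sQ (- v *m invmx B)) => z.
  by rewrite gaussz_lgram -vE.
- rewrite vE poisE; have := lo (- v *m invmx B); rewrite -(ler_pM2l C0); lra.
- by rewrite vE poisE ler_pM2l.
Qed.

End LatticeGaussian.

(** * Exponential tilting and the tail of long vectors *)

Section Tilting.
Context {R : realType}.
Variables (n : nat) (B : 'M[R]_n) (s S : R).
Hypotheses (s0 : 0 < s) (S0 : 0 < S).
Implicit Types (u v y : 'rV[R]_n) (t : R).

Let g (v : 'rV[R]_n) (z : 'rV[int]_n) : R := rho s (lpoint B z - v).

Hypothesis sg : forall v, summ (g v).
Hypothesis g_ge : forall v, S / 3 <= rsum (g v).
Hypothesis g_le : forall v, rsum (g v) <= S.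

Let w z : R := rho s (lpoint B z).
Let Z u z : R := dotp (lpoint B z) u / s.
Let N z : R := dotp (lpoint B z) (lpoint B z) / s ^+ 2.

Let sn : s != 0. Proof. by rewrite gt_eqF. Qed.

Lemma rho_ge0 m (x : R) (y : 'rV[R]_m) : 0 <= rho x y.
Proof. exact: expR_ge0. Qed.

(** Completing the square: the tilt moves the centre of the Gaussian to [t * s *: u], so [g_ge] and
    [g_le] become bounds on the moment generating function. *)
Let tilt t u z : dotp u u = 1 ->
  w z * expR (2 * pi * t * Z u z) = expR (pi * t ^+ 2) * g ((t * s) *: u) z.
Proof.
move=> u1; rewrite /w /g !rhoE -!expRD dotpBl !dotpDr !dotpNr !dotpZl !dotpZr u1.
rewrite (dotpC u) /Z; congr expR; move: (dotp _ _) (dotp _ u) => D U; field; exact: sn.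
Qed.

Let summ_tilt t u : dotp u u = 1 -> summ (fun z => w z * expR (2 * pi * t * Z u z)).
Proof.
move=> u1; apply: (@eq_summ _ _ (fun z => expR (pi * t ^+ 2) * g ((t * s) *: u) z)).
  by move=> z; rewrite tilt.
exact: summZ.
Qed.

Let tilt_ge t u : dotp u u = 1 ->
  expR (pi * t ^+ 2) * (S / 3) <= rsum (fun z => w z * expR (2 * pi * t * Z u z)).
Proof.
move=> u1; rewrite (eq_rsum (fun z => tilt t z u1)) rsumZ// ler_pM2l ?expR_gt0//.
Qed.

Let tilt_le t u : dotp u u = 1 ->
  rsum (fun z => w z * expR (2 * pi * t * Z u z)) <= expR (pi * t ^+ 2) * S.
Proof.
move=> u1; rewrite (eq_rsum (fun z => tilt t z u1)) rsumZ// ler_pM2l ?expR_gt0//.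
Qed.

(* z = 2 z' + c with c a vector of bits: the Gaussian of parameter 2 s on L
   is the sum of 2^n shifted Gaussians of parameter s. *)
Let parity (p : 'rV[bool]_n * 'rV[int]_n) : 'rV[int]_n :=
  \row_j (p.2 0 j * 2 + (p.1 0 j : nat)%:Z).

Let parity_bij : bijective parity.
Proof.
exists (fun z : 'rV[int]_n =>
  ((\row_j ((z 0%R j %% 2)%Z == 1)) : 'rV[bool]_n, (\row_j (z 0%R j %/ 2)%Z) : 'rV[int]_n)) => [[c y]|z].
  congr (_, _); apply/matrixP => i j; rewrite !ord1 !mxE /=; case: (c 0 j); lia.
by apply/matrixP => i j; rewrite !ord1 !mxE /=; case: eqP; lia.
Qed.

(** The weight 3/4 leaves [expR (- pi N / 4)], the Gaussian of parameter [2 s]. By Markov's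
    inequality this controls the points with [N > n]. *)
Lemma tail_sum : summ (fun z => w z * expR (3 / 4 * pi * N z)) /\
  rsum (fun z => w z * expR (3 / 4 * pi * N z)) <= 2 ^+ n * S.
Proof.
pose h z := rho s (2^-1 *: lpoint B z).
have wh z : w z * expR (3 / 4 * pi * N z) = h z.
  rewrite /w /h !rhoE -expRD /N dotpZl dotpZr; congr expR.
  by move: (dotp _ _) => D; field; exact: sn.
pose half (c : 'rV[bool]_n) : 'rV[R]_n := - (2^-1 *: ((\row_j ((c 0 j : nat)%:R)) *m B)).
have hp (c : 'rV[bool]_n) (y : 'rV[int]_n) : h (parity (c, y)) = g (half c) y.
  rewrite /h /g /half opprK /lpoint; congr (rho s _).
  rewrite !scalemxAl -mulmxDl; congr (_ *m _); apply/matrixP => i j.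
  by rewrite !ord1 !mxE intrD intrM /=; field.
have sp : summ (fun p => h (parity p)).
  apply: (@summ_pair _ _ _ _ (fun=> S)) => [c|c|]; last exact: (rsum_fin _).1.
    by apply: eq_summ (sg (half c)) => y; rewrite hp.
  rewrite (@eq_rsum _ _ _ (g (half c)))// => y.
  by rewrite hp ger0_norm ?rho_ge0.
have sh : summ h by rewrite (summ_bij h parity_bij).
have -> : (fun z => w z * expR (3 / 4 * pi * N z)) = h by apply/funext.
split=> //; rewrite (rsum_bij h parity_bij) rsum_pair// (rsum_fin _).2.
apply: le_trans (_ : \sum_(c : 'rV[bool]_n) S <= _).
  by apply: ler_sum => c _; rewrite (eq_rsum (hp c)).
by rewrite sumr_const card_mx card_bool mul1n -[leLHS]mulr_natl natrX.
Qed.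

Definition good_point (r : R) u y : bool :=
  (r <= dotp y u / s) && (dotp y y / s ^+ 2 <= n%:R).

(* Exponential tilting: under the weight [expR (2 pi t Z)], which multiplies the
   total mass by [expR (pi t^2)] up to a factor 3, the part outside the window
   [t - 1 <= Z <= t + 1] is bounded by the tilts [t - 1] and [t + 1]. *)
Lemma direction_lower_bound u t : dotp u u = 1 -> 0 <= t ->
  S * (expR (pi - pi * (t + 1) ^+ 2) * (1 / 3 - 2 * expR (- pi))
     - 2 ^+ n * expR (- (3 / 4 * pi * n%:R))) <=
  rsum (fun z => w z * (good_point (t - 1) u (lpoint B z))%:R).
Proof.
move=> u1 t0.
set P := rsum _; have [sT rT] := tail_sum.
pose K : R := expR (2 * pi * t * (t + 1)).
pose e0 := expR (- (3 / 4 * pi * n%:R)) : R.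
pose J z : R := e0 * expR (3 / 4 * pi * N z).
have w0 z : 0 <= w z by exact: rho_ge0.
have sw : summ w by apply: eq_summ (sg 0) => z; rewrite /g subr0.
have sI : summ (fun z => w z * (good_point (t - 1) u (lpoint B z))%:R).
  apply: summ_le sw => z; rewrite normrM (ger0_norm (w0 z)) normr_nat.
  by case: good_point; rewrite ?mulr1 ?mulr0.
(* Four cases, each with its own dominating term: in the window with [N <= n]; in the window with
   [N > n], where [J >= 1]; above [t + 1]; below [t - 1]. *)
have pw z : expR (2 * pi * t * Z u z) <=
    K * (good_point (t - 1) u (lpoint B z))%:R + K * J z
    + expR (- (2 * pi * (t + 1))) * expR (2 * pi * (t + 1) * Z u z)
    + expR (2 * pi * (t - 1)) * expR (2 * pi * (t - 1) * Z u z).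
  have pi0 := @pi_gt0 R.
  have K0 : 0 <= K by exact: expR_ge0.
  have J0 : 0 <= J z by rewrite mulr_ge0 ?expR_ge0.
  have KJ : 0 <= K * J z by rewrite mulr_ge0.
  have KI : 0 <= K * (good_point (t - 1) u (lpoint B z))%:R by rewrite mulr_ge0.
  rewrite -!expRD.
  set A1 := expR (- _ + _); set A2 := expR (_ + _).
  have A10 : 0 <= A1 by exact: expR_ge0.
  have A20 : 0 <= A2 by exact: expR_ge0.
  have [h1|h1] := ltP (t + 1) (Z u z).
    suff : expR (2 * pi * t * Z u z) <= A1 by lra.
    rewrite ler_expR -subr_ge0 (_ : _ - _ = 2 * pi * (Z u z - (t + 1))); last by ring.
    by rewrite !mulr_ge0 ?(ltW pi0)// subr_ge0 ltW.
  have [h2|h2] := ltP (Z u z) (t - 1).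
    suff : expR (2 * pi * t * Z u z) <= A2 by lra.
    rewrite ler_expR -subr_ge0 (_ : _ - _ = 2 * pi * ((t - 1) - Z u z)); last by ring.
    by rewrite !mulr_ge0 ?(ltW pi0)// subr_ge0 ltW.
  have h3 : expR (2 * pi * t * Z u z) <= K.
    by rewrite ler_expR ler_wpM2l// !mulr_ge0// ltW.
  rewrite /good_point h2 /=; have [h4|h4] := leP (N z) n%:R.
    by move: KJ KI; rewrite /good_point h2 /= h4 mulr1; lra.
  have J1 : 1 <= J z.
    rewrite /J -expRD -[leLHS]expR0 ler_expR addrC subr_ge0 ler_wpM2l ?(ltW h4)//.
    by rewrite mulr_ge0// ltW.
  have KKJ : K <= K * J z by apply: ler_peMr.
  by rewrite /= mulr0; lra.
have sJ : summ (fun z => w z * J z).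
  by apply: eq_summ (summZ e0 sT) => z; rewrite /J mulrCA.
have rJ : rsum (fun z => w z * J z) <= e0 * (2 ^+ n * S).
  under eq_rsum do rewrite /J mulrCA.
  by rewrite rsumZ// ler_wpM2l ?expR_ge0.
have key : rsum (fun z => w z * expR (2 * pi * t * Z u z)) <=
    K * P + K * rsum (fun z => w z * J z)
    + expR (- (2 * pi * (t + 1))) * rsum (fun z => w z * expR (2 * pi * (t + 1) * Z u z))
    + expR (2 * pi * (t - 1)) * rsum (fun z => w z * expR (2 * pi * (t - 1) * Z u z)).
  have s1 := summ_tilt (t + 1) u1; have s2 := summ_tilt (t - 1) u1.
  pose F1 z := K * (w z * (good_point (t - 1) u (lpoint B z))%:R).
  pose F2 z := K * (w z * J z).
  pose F3 z := expR (- (2 * pi * (t + 1))) * (w z * expR (2 * pi * (t + 1) * Z u z)).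
  pose F4 z := expR (2 * pi * (t - 1)) * (w z * expR (2 * pi * (t - 1) * Z u z)).
  have S1 : summ F1 by exact: (summZ K sI).
  have S2 : summ F2 by exact: (summZ K sJ).
  have S3 : summ F3 by exact: (summZ _ s1).
  have S4 : summ F4 by exact: (summZ _ s2).
  have S12 := summD S1 S2; have S123 := summD S12 S3; have S1234 := summD S123 S4.
  have <- : rsum F1 = K * P by exact: (rsumZ K sI).
  have <- : rsum F2 = K * rsum (fun z => w z * J z) by exact: (rsumZ K sJ).
  rewrite -(rsumZ _ s1) -(rsumZ _ s2) -(rsumD S1 S2) -(rsumD S12 S3) -(rsumD S123 S4).
  apply: (ler_rsum (summ_tilt t u1) S1234) => z.
  apply: le_trans (ler_wpM2l (w0 z) (pw z)) _.
  by rewrite le_eqVlt /F1 /F2 /F3 /F4; apply/orP; left; apply/eqP; ring.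
have k1 := tilt_ge t u1; have k2 := tilt_le (t + 1) u1; have k3 := tilt_le (t - 1) u1.
have {}k2 := ler_wpM2l (expR_ge0 (- (2 * pi * (t + 1)))) k2.
have {}k3 := ler_wpM2l (expR_ge0 (2 * pi * (t - 1))) k3.
rewrite mulrA -expRD in k2; rewrite mulrA -expRD in k3.
(* Each outer part is at most [expR (pi t^2) * expR (- pi) * S], against a tilted mass of at least
   [expR (pi t^2) * S / 3]. Half-width 1 suffices because [2 * expR (- pi) < 1 / 3]. *)
have e2 : - (2 * pi * (t + 1)) + pi * (t + 1) ^+ 2 = pi * t ^+ 2 + - pi :> R by ring.
have e3 : 2 * pi * (t - 1) + pi * (t - 1) ^+ 2 = pi * t ^+ 2 + - pi :> R by ring.
rewrite e2 expRD in k2; rewrite e3 expRD in k3.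
have K0 : 0 < K by exact: expR_gt0.
rewrite -(ler_pM2l K0).
have eK : K * expR (pi - pi * (t + 1) ^+ 2) = expR (pi * t ^+ 2).
  by rewrite /K -expRD; congr expR; ring.
have rJ' := ler_wpM2l (ltW K0) rJ.
rewrite mulrCA mulrBr mulrA eK.
move: k1 k2 k3 key rJ'; rewrite -/e0.
set X := expR (pi * t ^+ 2); set Y := expR (- pi); lra.
Qed.

End Tilting.

(** * Numerical constants and the gain of one shortening step *)

Section Numerics.
Context {R : realType}.

(** The Taylor bounds give the sign of the cosine at 1.4, and in the next lemma at 1.6, which
    locates [pi / 2] between them. *)
Lemma pi_ge28 : 28 / 10 <= pi :> R.
Proof.
rewrite leNgt; apply/negP => h; have p2 := @pi_ge2 R.
have c : 0 < cos (14 / 10 : R).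
  by apply: lt_le_trans (cos_ge _); [lra|lra].
have : cos (14 / 10 : R) < cos (pi / 2).
  by rewrite ltr_cos ?in_itv/=; [lra|apply/andP; split; lra|apply/andP; split; lra].
by rewrite cos_pihalf; lra.
Qed.

Lemma pi_le32 : pi <= 32 / 10 :> R.
Proof.
rewrite leNgt; apply/negP => h.
have : 0 < cos (16 / 10 : R) by apply: cos_gt0_pihalf; apply/andP; split; lra.
have : cos (16 / 10 : R) <= 1 - (16 / 10) ^+ 2 / 2 + (16 / 10) ^+ 4 / 24.
  by apply: cos_le; lra.
by lra.
Qed.

Lemma sqrt_pi_le : Num.sqrt pi <= 179 / 100 :> R.
Proof.
have p0 := @pi_ge0 R; have h := pi_le32.
have -> : 179 / 100 = Num.sqrt ((179 / 100) ^+ 2) :> R by rewrite sqrtr_sqr ger0_norm//; lra.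
by rewrite ler_sqrt; lra.
Qed.

Lemma expR_pi_ge : 14 <= expR pi :> R.
Proof.
apply: le_trans (_ : expR (10^-1) ^+ 28 <= _); last first.
  by rewrite -expRM_natr ler_expR; have := pi_ge28; lra.
apply: le_trans (_ : (1 + 10^-1) ^+ 28 <= _); first by lra.
by rewrite lerXn2r ?nnegrE ?expR_ge0 ?expR_ge1Dx//; lra.
Qed.

Lemma expRN1_le : expR (- 1) <= 1 / 2 :> R.
Proof.
rewrite expRN mul1r lef_pV2 ?posrE ?expR_gt0//.
by apply: le_trans (expR_ge1Dx _); lra.
Qed.

Lemma exp2_le_expR n : 2 ^+ n <= expR n%:R :> R.
Proof.
rewrite -[n%:R]mul1r expRM_natr lerXn2r ?nnegrE ?expR_ge0//.
by apply: le_trans (expR_ge1Dx _); lra.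
Qed.

(** The choice of [t] turns [pi (t + 1)^2] into [(x + 4)^2]. Since [expR pi >= 14], the coefficient
    is at least [14/3 - 2 = 8/3]; the tail of long vectors takes 1/2 of it and leaves more than
    2. *)
Lemma prob_bound (n : nat) (x t : R) : (40 <= n)%N -> 0 <= x -> x ^+ 2 <= n%:R / 16 ->
  t + 1 = (x + 4) / Num.sqrt pi ->
  2 * expR (- (x + 4) ^+ 2) <=
  expR (pi - pi * (t + 1) ^+ 2) * (1 / 3 - 2 * expR (- pi))
     - 2 ^+ n * expR (- (3 / 4 * pi * n%:R)).
Proof.
move=> n40 x0 xn ->.
have n40' : 40 <= n%:R :> R by rewrite ler_nat.
have p0 := @pi_gt0 R.
have sp : Num.sqrt pi ^+ 2 = pi :> R by rewrite sqr_sqrtr// ltW.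
have -> : pi * ((x + 4) / Num.sqrt pi) ^+ 2 = (x + 4) ^+ 2.
  by rewrite exprMn exprVn sp mulrCA mulfV ?mulr1// gt_eqF.
rewrite expRD (mulrC (expR pi)) -(mulrA (expR (- (x + 4) ^+ 2)) (expR pi)).
have -> : expR pi * (1 / 3 - 2 * expR (- pi)) = expR pi / 3 - 2 :> R.
  have h1 : expR pi * expR (- pi) = 1 :> R by rewrite -expRD subrr expR0.
  by rewrite mulrBr (mulrCA _ 2) h1; lra.
have h14 := expR_pi_ge.
have tail : 2 ^+ n * expR (- (3 / 4 * pi * n%:R)) <= expR (- (x + 4) ^+ 2) * (1 / 2).
  apply: le_trans (_ : expR n%:R * expR (- (3 / 4 * pi * n%:R)) <= _).
    by rewrite ler_wpM2r ?expR_ge0// exp2_le_expR.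
  apply: le_trans (_ : expR (- (x + 4) ^+ 2) * expR (- 1) <= _); last first.
    by rewrite ler_wpM2l ?expR_ge0// expRN1_le.
  rewrite -!expRD ler_expR.
  (* [(x + 4)^2 <= 2 x^2 + 32 <= n / 8 + 32], while the tail exponent is at least
     [(3/4 * 2.8 - 1) n = 1.1 n]; here [n >= 40] is used. *)
  have h := pi_ge28; have : 28 / 10 * n%:R <= pi * n%:R :> R by rewrite ler_wpM2r.
  have := sqr_ge0 (x - 4); lra.
set E := expR (- (x + 4) ^+ 2) in tail *; have E0 : 0 < E by exact: expR_gt0.
have : E * (14 / 3 - 2) <= E * (expR pi / 3 - 2) by rewrite ler_pM2l//; lra.
lra.
Qed.

(** The 4 is spent here: [4 / sqrt pi] exceeds 2 + 1/8, the width of the window plus the loss from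
    the net. *)
Lemma radius_bound (x t : R) : 1 <= x -> t + 1 = (x + 4) / Num.sqrt pi ->
  0 <= t /\ 55 / 100 * x <= t - 1 - 1 / 8.
Proof.
move=> x1 tE; have sp := sqrt_pi_le.
have sp0 : 0 < Num.sqrt pi :> R by rewrite sqrtr_gt0 pi_gt0.
have : (x + 4) / (179 / 100) <= (x + 4) / Num.sqrt pi.
  by rewrite ler_wpM2l ?lef_pV2 ?posrE//; lra.
by rewrite -tE; split; lra.
Qed.

(* [k] is 1 or the integer part of the optimal coefficient [a / bb]. *)
Lemma reduction_exists (n : nat) (tt a bb : R) : (40 <= n)%N -> 0 < bb ->
  55 / 100 * bb <= a -> 3 / 10 * (tt * bb) <= a ^+ 2 * n%:R ->
  exists k : int, tt - 2 * k%:~R * a + k%:~R ^+ 2 * bb <= shrink n * tt.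
Proof.
move=> n40 bb0 ab h.
have n40' : 40 <= n%:R :> R by rewrite ler_nat.
have n0 : 0 < n%:R :> R by lra.
have n2 : 0 < n%:R ^+ 2 :> R by rewrite exprn_gt0.
pose q := a / bb.
have aE : a = q * bb by rewrite /q divfK// gt_eqF.
have q0 : 55 / 100 <= q by rewrite /q ler_pdivlMr.
(* The required decrease: the last hypothesis gives [tt / n^2 <= (10/3) q^2 bb / n], and [n >= 40]
   turns 10/3 into 1/12. *)
have tn : tt / n%:R ^+ 2 <= q ^+ 2 * bb / 12.
  rewrite ler_pdivrMr//.
  have : 3 / 10 * tt <= q ^+ 2 * bb * n%:R.
    rewrite -(ler_pM2r bb0) -(mulrA (3 / 10)); apply: le_trans h _.
    by rewrite aE le_eqVlt; apply/orP; left; apply/eqP; ring.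
  have : 40 * (q ^+ 2 * bb * n%:R) <= n%:R * (q ^+ 2 * bb * n%:R).
    apply: ler_wpM2r n40'; apply: mulr_ge0 (ltW n0).
    by apply: mulr_ge0 (ltW bb0); exact: sqr_ge0.
  by lra.
rewrite /shrink mulrBl mul1r.
suff [k hk] : exists k : int, q ^+ 2 / 12 <= k%:~R * (2 * q - k%:~R).
  exists k; have := ler_wpM2r (ltW bb0) hk; rewrite aE; move: tn.
  by rewrite [tt / _]mulrC; lra.
(* For [q < 1] the choice [k = 1] gains [2 q - 1 >= 1/10 > 1/12], which explains 55/100. Otherwise
   the integer part is at least [q / 2] and gains [q^2 / 2]. *)
have [q1|q1] := ltP q 1.
  exists 1; have : q ^+ 2 <= 1 by rewrite exprn_ile1//; lra.
  lra.
exists (Num.floor q); have /andP[f1 f2] := floor_itv q.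
have f0 : 1 <= (Num.floor q)%:~R :> R by rewrite ler1z; move: q1; rewrite -[X in X <= _]/(1%:~R) floor_ge_int.
rewrite intrD in f2; set f : R := _%:~R in f0 f1 f2 *.
have : q / 2 * q <= f * (2 * q - f) by apply: ler_pM; lra.
have := sqr_ge0 q; lra.
Qed.

End Numerics.

(** * Independent samples *)

Section Sampling.
Context {R : realType} {n : nat} {disp : measure_display} {T : measurableType disp}.
Variables (P : probability T R) (B : 'M[R]_n) (s : R).
Hypothesis freeB : row_free B.
Local Notation L := (lattice_of B).

Lemma lattice_mem (y : 'rV[R]_n) : L y -> exists z, y = lpoint B z.
Proof. by move=> [z ->]; exists z. Qed.

Lemma lpoint_lattice z : L (lpoint B z).
Proof. by exists z. Qed.

(* The samples take countably many values. *)
Lemma measurable_samples N (Y : 'I_N -> T -> 'rV[R]_n) (D : ('I_N -> 'rV[R]_n) -> Prop) :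
  (forall i, has_dgauss_law P (Y i) L s) -> measurable [set omega | D (Y ^~ omega)].
Proof.
move=> lawY.
have -> : [set omega | D (Y ^~ omega)] = \bigcup_(f : {ffun 'I_N -> 'rV[int]_n})
    [set omega | D (fun i => lpoint B (f i)) /\ forall i, Y i omega = lpoint B (f i)].
  apply/seteqP; split=> omega /=.
    move=> Dw; have /choice[f fP] : forall i, exists z, Y i omega = lpoint B z.
      by move=> i; apply: lattice_mem; exact: (lawY i).1.
    exists [ffun i => f i] => //=; split; last by move=> i; rewrite ffunE.
    by rewrite (_ : (fun i => _) = Y ^~ omega)//; apply/funext => i; rewrite ffunE.
  by move=> [f _ [Df Yf]]; rewrite (_ : Y ^~ omega = fun i => lpoint B (f i))//; apply/funext.
apply: countable_bigcupT_measurable => [|f]; first exact: countableP.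
have [Df|nDf] := pselect (D (fun i => lpoint B (f i))); last first.
  rewrite (_ : [set _ | _] = set0) ?measurable0//.
  by apply/seteqP; split=> // omega [].
rewrite (_ : [set _ | _] = \bigcap_(i in [set: 'I_N]) (Y i @^-1` [set lpoint B (f i)])).
  apply: fin_bigcap_measurable => // i _.
  exact: ((lawY i).2 _ (lpoint_lattice _)).1.
by apply/seteqP; split=> omega /= => [[_ H] i _|H]; [exact: H|split=> // i; exact: H].
Qed.

Lemma law_seq (X : T -> 'rV[R]_n) (t : seq 'rV[int]_n) : has_dgauss_law P X L s -> uniq t ->
  measurable (X @^-1` [set lpoint B z | z in [set` t]]) /\
  P (X @^-1` [set lpoint B z | z in [set` t]]) = (\sum_(z <- t) dgauss L s (lpoint B z))%:E.
Proof.
move=> lawX; elim: t => [_|z t IH /= /andP[zt ut]].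
  rewrite big_nil (_ : _ @^-1` _ = set0); last by apply/seteqP; split=> // w [z].
  by split; [exact: measurable0|rewrite measure0].
have [mt Pt] := IH ut; have [mz Pz] := lawX.2 _ (lpoint_lattice z).
have -> : X @^-1` [set lpoint B z0 | z0 in [set` z :: t]] =
    X @^-1` [set lpoint B z] `|` X @^-1` [set lpoint B z | z in [set` t]].
  apply/seteqP; split=> w /=.
    by move=> [y]; rewrite inE => /predU1P[-> <-|yt <-]; [left|right; exists y].
  move=> [->|[y yt <-]]; first by exists z => //; rewrite inE eqxx.
  by exists y => //; rewrite inE yt orbT.
split; first exact: measurableU.
rewrite big_cons EFinD -Pz -Pt; apply: measureU => //.
apply/seteqP; split=> // w /= [-> [y yt]].
by move=> /(lpoint_inj freeB) yz; move: zt; rewrite -yz yt.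
Qed.

(** The sum is a supremum of finite sums, each of which is the probability of a measurable
    subevent. *)
Lemma law_ge (X : T -> 'rV[R]_n) (A : 'rV[R]_n -> bool) (p : R) :
  has_dgauss_law P X L s -> measurable [set omega | A (X omega)] ->
  (forall z, 0 <= dgauss L s (lpoint B z)) ->
  p <= rsum (fun z => dgauss L s (lpoint B z) * (A (lpoint B z))%:R) ->
  (p%:E <= P [set omega | A (X omega)])%E.
Proof.
move=> lawX mA d0 pr.
have fP := fin_num_measure P _ mA; rewrite -(fineK fP) lee_fin; apply: le_trans pr _.
apply: rsum_le => [z|t ut]; first by rewrite mulr_ge0.
rewrite -lee_fin fineK//.
have uf := filter_uniq (fun z => A (lpoint B z)) ut.
have [mt Pt] := law_seq lawX uf.
rewrite (_ : \sum_(z <- t) _ = \sum_(z <- [seq z <- t | A (lpoint B z)]) dgauss L s (lpoint B z)).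
  rewrite -Pt le_measure ?inE//= => w /= [z]; rewrite mem_filter => /andP[Az _] <-.
  exact: Az.
rewrite big_filter [RHS]big_mkcond; apply: eq_bigr => z _.
by case: (A _); rewrite ?mulr1 ?mulr0.
Qed.

Lemma prode_le N (q : 'I_N -> \bar R) (c : R) : 0 <= c ->
  (forall i, 0 <= q i <= c%:E)%E -> (\prod_(i < N) q i <= (c ^+ N)%:E)%E.
Proof.
elim: N q => [|N IH] q c0 qc; first by rewrite big_ord0.
rewrite big_ord_recl exprS EFinM; have /andP[q0 q1] := qc ord0.
apply: lee_pmul => //; first by apply: prode_ge0 => i _; have /andP[] := qc (lift ord0 i).
by apply: IH => // i; exact: qc.
Qed.

Lemma covering_probability N (Y : 'I_N -> T -> 'rV[R]_n) (I : finType)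
    (A : I -> 'rV[R]_n -> bool) (p : R) :
  iid_dgauss P Y L s -> 0 <= p ->
  (forall z, 0 <= dgauss L s (lpoint B z)) ->
  (forall f, p <= rsum (fun z => dgauss L s (lpoint B z) * (A f (lpoint B z))%:R)) ->
  (P [set omega | forall f, exists i, A f (Y i omega)] >=
    (1 - #|I|%:R * expR (- (p * N%:R)))%:E)%E.
Proof.
move=> [lawY indY] p0 d0 pA.
have mD := measurable_samples _ lawY.
pose bad f := [set omega | forall i, ~~ A f (Y i omega)].
have mbad f : measurable (bad f) by exact: (mD (fun y => forall i, ~~ A f (y i))).
have mY f i : measurable [set omega | A f (Y i omega)] by exact: (mD (fun y => A f (y i))).
have Pbad f : (P (bad f) <= (expR (- (p * N%:R)))%:E)%E.
  have mc i : measurable (Y i @^-1` [set y | ~~ A f y]).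
    exact: (mD (fun y => ~~ A f (y i))).
  have := indY (fun=> [set y | ~~ A f y]) mc; rewrite -/(bad f) => ->.
  (* Some sample is needed to compare [p] with a probability. Without samples the claimed bound is
     1, the empty product. *)
  have p1 : (0 < N)%N -> p <= 1.
    move=> N0; have := law_ge (lawY (Ordinal N0)) (mY f _) d0 (pA f).
    by move=> /le_trans /(_ (probability_le1 _ (mY f _))); rewrite lee_fin.
  have [N0|N0] := posnP N.
    by move: (Y) mc; rewrite N0 => Y' _; rewrite big_ord0 mulr0 oppr0 expR0.
  apply: le_trans (prode_le (c := 1 - p) _ _) _ => [|i|]; first by rewrite subr_ge0 p1.
    rewrite measure_ge0/= (_ : _ @^-1` _ = ~` [set omega | A f (Y i omega)]); last first.
      by apply/seteqP; split=> w /= /negP.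
    rewrite probability_setC// EFinB leeB// law_ge//.
  rewrite lee_fin -mulNr expRM_natr lerXn2r ?nnegrE ?expR_ge0 ?subr_ge0 ?p1//.
  exact: expR_ge1Dx.
have PU (t : seq I) : measurable (\big[setU/set0]_(f <- t) bad f) /\
    (P (\big[setU/set0]_(f <- t) bad f) <= ((size t)%:R * expR (- (p * N%:R)))%:E)%E.
  elim: t => [|f t [mt Pt]]; first by rewrite big_nil measure0 mul0r; split.
  rewrite big_cons; split; first exact: measurableU.
  apply: le_trans (measureU2 _ (mbad f) mt) _.
  by rewrite /= -natr1 addrC mulrDl mul1r EFinD leeD.
have [mU PUe] := PU (enum I).
have mS : measurable [set omega | forall f, exists i, A f (Y i omega)].
  exact: (mD (fun y => forall f, exists i, A f (y i))).
have <- : ~` (\big[setU/set0]_(f <- enum I) bad f) = [set omega | forall f, exists i, A f (Y i omega)].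
  apply/seteqP; split=> w.
    move=> nU f; apply: contrapT => nE; apply: nU.
    rewrite -bigcup_seq; exists f; first by rewrite /= mem_enum.
    by move=> i; apply/negP => Ai; apply: nE; exists i.
  by move=> H; rewrite -bigcup_seq => -[f _ bf]; have [i] := H f; apply/negP; exact: bf.
rewrite probability_setC// EFinB leeB//.
by rewrite cardE.
Qed.

End Sampling.

(** * The reduction algorithm *)

Section Reduction.
Context {R : realType} {n : nat}.
Implicit Types (t u v y : 'rV[R]_n).

Lemma latticeD (B : 'M[R]_n) u v : lattice_of B u -> lattice_of B v -> lattice_of B (u + v).
Proof.
by move=> [z ->] [z' ->]; exists (z + z'); rewrite -mulmxDl map_mxD.
Qed.

Lemma latticeZ (B : 'M[R]_n) (k : int) u : lattice_of B u -> lattice_of B (k%:~R *: u).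
Proof.
move=> [z ->]; exists (k *: z); rewrite scalemxAl; congr (_ *m _).
by apply/matrixP => i j; rewrite !mxE intrM.
Qed.

Lemma latticeN (B : 'M[R]_n) u : lattice_of B u -> lattice_of B (- u).
Proof. by move=> /(latticeZ (-1)); rewrite scaleN1r. Qed.

Lemma dotp_sub_scale t (k : R) y :
  dotp (t - k *: y) (t - k *: y) = dotp t t - 2 * k * dotp t y + k ^+ 2 * dotp y y.
Proof.
rewrite dotpBl !dotpDr !dotpNr !dotpZl !dotpZr (dotpC y t); ring.
Qed.

Lemma shrink_ge0 : (1 <= n)%N -> 0 <= shrink n :> R.
Proof.
move=> n1; rewrite subr_ge0 invf_le1 ?exprn_gt0 ?ltr0n// exprn_ege1// ler1n//.
Qed.

Section Run.
Variables (N : nat) (Y : 'I_N -> 'rV[R]_n).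

Lemma run_coset (B : 'M[R]_n) m t u : (forall i, lattice_of B (Y i)) ->
  reduction_run Y m t u -> lattice_of B (t - u).
Proof.
have L0 x : lattice_of B (x - x).
  by rewrite subrr; exists 0; rewrite map_mx0 mul0mx.
move=> LY; elim=> {m t u} [t|m t _|m t t' u [i [k [-> _]]] _ IH] //.
rewrite (_ : t - u = k%:~R *: Y i + (t - k%:~R *: Y i - u)); first by apply: latticeD => //; exact: latticeZ.
by rewrite !addrA [_ + t]addrC addrK.
Qed.

(** A run that does not end stuck has used all its [m] steps, so the contractions multiply. *)
Lemma run_end m t u : (1 <= n)%N -> reduction_run Y m t u ->
  (forall t', ~ reduction_step Y u t') \/ enorm u ^+ 2 <= shrink n ^+ m * enorm t ^+ 2.
Proof.
move=> n1; elim=> {m t u} [t|m t st|m t t' u [i [k [_ h]]] _ [IH|IH]]; [|by left|by left|].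
  by right; rewrite expr0 mul1r.
by right; apply: le_trans IH _; rewrite (exprSr _ m) -mulrA ler_wpM2l// exprn_ge0// shrink_ge0.
Qed.

End Run.

(** For [k = k0 + d] the difference is [bb * d * (d - 2 (q - k0))], where [|q - k0| <= 1/2] and a
    nonzero [d] has [|d| >= 1]. *)
Lemma round_optimal (a bb : R) (k k0 : int) : 0 <= bb -> (bb = 0 -> a = 0) ->
  k0 = Num.floor (a / bb + 2^-1) ->
  - (2 * k0%:~R * a) + k0%:~R ^+ 2 * bb <= - (2 * k%:~R * a) + k%:~R ^+ 2 * bb.
Proof.
move=> b0 ab0 k0E; have [bb0|bb0] := eqVneq bb 0.
  by rewrite (ab0 bb0) bb0 !mulr0.
set q := a / bb in k0E; have aE : a = q * bb by rewrite /q divfK.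
have /andP[f1 f2] := floor_itv (q + 2^-1); rewrite -k0E intrD in f1 f2.
pose d := k - k0; have kE : k = k0 + d by rewrite /d addrC subrK.
suff h : 0 <= d%:~R * (d%:~R - 2 * (q - k0%:~R)).
  have := mulr_ge0 b0 h; rewrite aE kE intrD; lra.
have [d0|d0|->] := ltrgtP d 0; last by rewrite mul0r.
  have d1 : d%:~R <= -1 :> R by rewrite -[-1]/((-1)%:~R) ler_int; lia.
  by rewrite mulr_le0//; lra.
have d1 : 1 <= d%:~R :> R by rewrite -[1]/(1%:~R) ler_int; lia.
by rewrite mulr_ge0//; lra.
Qed.

(** In the [None] case every [k] is excluded although one was tried per vector, because that one is
    optimal. *)
Lemma search_correct (ys : seq 'rV[R]_n) t :
  match (search ys t).1 with
  | Some t' => exists2 y, y \in ys &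
      exists k : int, t' = t - k%:~R *: y /\ dotp t' t' <= shrink n * dotp t t
  | None => forall y, y \in ys -> forall k : int,
      ~ dotp (t - k%:~R *: y) (t - k%:~R *: y) <= shrink n * dotp t t
  end.
Proof.
elim: ys => [//|y ys IH] /=.
set k0 := Num.floor _; case: ifP => /= h.
  by exists y; [rewrite inE eqxx|exists k0].
case: (search ys t).1 IH => [t' [y' yin H]|H].
  by exists y' => //; rewrite inE yin orbT.
move=> y'; rewrite inE => /predU1P[-> k hk|]; last exact: H.
move/negP: h; apply; apply: le_trans hk; rewrite !dotp_sub_scale -!addrA lerD2l.
apply: round_optimal => //; first exact: dotp_ge0.
by move=> /dotp_eq0 ->; rewrite dotpC dotp0l.
Qed.

(** Per vector: four inner products and one scaled subtraction at [2 n] each, and 7 scalar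
    operations. *)
Lemma search_cost (ys : seq 'rV[R]_n) t :
  ((search ys t).2 <= size ys * (10 * n + 7))%N.
Proof.
elim: ys => [//|y ys IH] /=; case: ifP => _ /=; lia.
Qed.

Lemma reduce_correct N (Y : 'I_N -> 'rV[R]_n) m t :
  reduction_run Y m t (reduce [seq Y i | i <- enum 'I_N] m t).1.
Proof.
elim: m t => [|m IH] t /=; first exact: run_limit.
have := search_correct [seq Y i | i <- enum 'I_N] t.
case: (search _ t).1 => [t' [y /mapP[i _ ->] [k [t'E h]]]|H] /=.
  by apply: (run_step (t' := t')) => //; exists i, k; rewrite !enorm_sqr.
apply: run_stuck => t' [i [k [-> ]]]; rewrite !enorm_sqr; apply: H.
by apply: map_f; rewrite mem_enum.
Qed.

Lemma reduce_cost (ys : seq 'rV[R]_n) m t :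
  ((reduce ys m t).2 <= m * (size ys * (10 * n + 7)))%N.
Proof.
elim: m t => [|m IH] t //=; have h := search_cost ys t.
case: (search ys t).1 => [t'|] /=; last by nia.
by have := IH t'; nia.
Qed.

(** Links the timed program to the nondeterministic runs, for all of which success is proved. *)
Lemma query_correct N (Y : 'I_N -> 'rV[R]_n) babai t :
  gdd_output Y (babai t).1 t (gdd_query babai Y t).1.
Proof.
by exists (reduce [seq Y i | i <- enum 'I_N] (max_steps n) (babai t).1).1 => //; exact: reduce_correct.
Qed.

Lemma query_cost N (Y : 'I_N -> 'rV[R]_n) babai t :
  ((gdd_query babai Y t).2 <= (babai t).2 + (100 * n ^ 3 * (N * (10 * n + 7)) + n))%N.
Proof.
rewrite /gdd_query /= leq_add2l leq_add2r.
by have := reduce_cost [seq Y i | i <- enum 'I_N] (max_steps n) (babai t).1;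
  rewrite size_map size_enum_ord.
Qed.

End Reduction.

(** * Covering all targets *)

Section Covering.
Context {R : realType} {n : nat}.
Implicit Types (u v w y : 'rV[R]_n).

Lemma cauchy_schwarz y w : dotp y w ^+ 2 <= dotp y y * dotp w w.
Proof.
have [w0|w0] := eqVneq (dotp w w) 0.
  by rewrite (dotp_eq0 w0) dotpC !dotp0l expr0n mulr0.
have wp : 0 < dotp w w by rewrite lt_neqAle eq_sym w0 dotp_ge0.
have := dotp_ge0 (y - (dotp y w / dotp w w) *: w); rewrite dotp_sub_scale => h.
rewrite -ler_pdivrMr// -subr_ge0; apply: le_trans h _.
by rewrite le_eqVlt; apply/orP; left; apply/eqP; field.
Qed.

(** For a unit vector the floors lie between [- 8 n] and [8 n]; the shift makes them natural numbers
    at most [16 n], so [inord] loses nothing. *)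
Definition cell u : {ffun 'I_n -> 'I_(16 * n).+1} :=
  [ffun i => inord `|(Num.floor (8 * n%:R * u 0 i) + (8 * n)%:Z)%R|%N].

Lemma unit_coord u i : dotp u u = 1 -> `|u 0 i| <= 1.
Proof.
move=> u1; rewrite -(@ler_pXn2r _ 2) ?nnegrE// expr1n real_normK ?num_real//.
rewrite -u1 /dotp (bigD1 i)//= expr2 lerDl sumr_ge0// => j _.
by rewrite -expr2 sqr_ge0.
Qed.

(** The [n] coordinates differ by at most [1 / (8 n)] each. The resulting distance [1 / (8 sqrt n)]
    is tuned to samples of norm at most [sqrt n * s]. *)
Lemma cell_close u v : (0 < n)%N -> dotp u u = 1 -> dotp v v = 1 -> cell u = cell v ->
  dotp (u - v) (u - v) <= (64 * n%:R)^-1.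
Proof.
move=> n0 u1 v1 /ffunP cuv.
have n0' : 0 < n%:R :> R by rewrite ltr0n.
pose c : R := 8 * n%:R; have c0 : 0 < c by rewrite mulr_gt0.
have cE : ((8 * n)%:Z%:~R : R) = c by rewrite -pmulrn natrM.
have rng w i : dotp w w = 1 -> - (8 * n)%:Z <= Num.floor (c * w 0 i) <= (8 * n)%:Z.
  move=> /(unit_coord i); rewrite ler_norml => /andP[h1 h2].
  apply/andP; split.
    by rewrite floor_ge_int intrN cE -mulrN1 ler_pM2l.
  by rewrite -(ler_int R) cE (le_trans (floor_le _))// -[leRHS]mulr1 ler_pM2l.
have fl i : Num.floor (c * u 0 i) = Num.floor (c * v 0 i).
  have := cuv i; rewrite !ffunE -/c => /(congr1 (@nat_of_ord _)).
  have /andP[a1 a2] := rng u i u1; have /andP[b1 b2] := rng v i v1.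
  by rewrite !inordK; lia.
have h i : ((u - v) 0 i) * ((u - v) 0 i) <= (c ^+ 2)^-1.
  have /andP[a1 a2] := floor_itv (c * u 0 i); have /andP[b1 b2] := floor_itv (c * v 0 i).
  rewrite fl in a1 a2; rewrite intrD in a2 b2.
  rewrite -expr2 -exprVn -[leLHS]real_normK ?num_real// lerXn2r ?nnegrE ?invr_ge0 ?(ltW c0)//.
  rewrite -(ler_pM2l c0) mulfV ?gt_eqF// -{1}(gtr0_norm c0) -normrM !mxE mulrBr ler_norml.
  by apply/andP; split; lra.
apply: le_trans (ler_sum _ (fun i _ => h i)) _.
rewrite sumr_const card_ord -mulr_natl /c le_eqVlt; apply/orP; left; apply/eqP.
by field; rewrite gt_eqF.
Qed.

(* One unit vector for each cell of a grid of mesh 1 / (8 n) that contains some. *)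
Lemma unit_net : (0 < n)%N -> exists U : {ffun 'I_n -> 'I_(16 * n).+1} -> 'rV[R]_n,
  (forall f, dotp (U f) (U f) = 1) /\
  forall u, dotp u u = 1 -> exists f, dotp (u - U f) (u - U f) <= (64 * n%:R)^-1.
Proof.
move=> n0.
have /choice[U UP] : forall f : {ffun 'I_n -> 'I_(16 * n).+1}, exists v : 'rV[R]_n,
    dotp v v = 1 /\ forall u, dotp u u = 1 -> cell u = f -> cell v = f.
  move=> f.
  have [[u [u1 cu]]|nu] := pselect (exists u, dotp u u = 1 /\ cell u = f).
    by exists u.
  (* A cell without unit vectors still needs a value of norm 1, as the probability bound is applied
     to every [U f]. *)
  exists (delta_mx 0 (Ordinal n0)); split.
    rewrite /dotp (bigD1 (Ordinal n0))//= big1 => [|i /negbTE i0].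
      by rewrite !mxE !eqxx mulr1 addr0.
    by rewrite !mxE i0 mulr0.
  by move=> u u1 cu; exfalso; apply: nu; exists u.
exists U; split=> [f|u u1]; first exact: (UP f).1.
exists (cell u); apply: cell_close => //; first exact: (UP _).1.
by rewrite ((UP (cell u)).2 u).
Qed.

(** By Cauchy-Schwarz the net costs at most [s / 8], so some sample [y] has inner product at least
    [0.55 x s] with the direction of [v]. Then [d * x = n * s] turns [|v| > d] into
    [dotp v y >= 0.55 n s^2 >= 0.55 |y|^2]. *)
Lemma step_exists N (Y : 'I_N -> 'rV[R]_n) (s r x d : R)
    (I : Type) (U : I -> 'rV[R]_n) v :
  (40 <= n)%N -> 0 < s -> 1 <= x -> 55 / 100 * x <= r - 1 / 8 -> d * x = n%:R * s ->
  (forall u, dotp u u = 1 -> exists f, dotp (u - U f) (u - U f) <= (64 * n%:R)^-1) ->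
  (forall f, exists i, good_point s r (U f) (Y i)) ->
  0 <= d -> d ^+ 2 < dotp v v -> exists v', reduction_step Y v v'.
Proof.
move=> n40 s0 x1 xr dx net good d0 dv.
have n0 : 0 < n%:R :> R by rewrite ltr0n; lia.
have vp : 0 < dotp v v by rewrite (le_lt_trans _ dv)// sqr_ge0.
pose V := enorm v; have V2 : V ^+ 2 = dotp v v by exact: enorm_sqr.
have V0 : 0 < V by rewrite sqrtr_gt0.
have dV : d <= V by rewrite -(@ler_pXn2r _ 2) ?nnegrE// ?(ltW V0)// V2 ltW.
pose u := V^-1 *: v.
have u1 : dotp u u = 1 by rewrite dotpZl dotpZr -V2; field; rewrite gt_eqF.
have [f uf] := net u u1; have [i /andP[g1 g2]] := good f.
set y := Y i in g1 g2.
move: g1 g2; rewrite ler_pdivlMr// ler_pdivrMr ?exprn_gt0// => g1 g2.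
have pert : `|dotp y (u - U f)| <= 1 / 8 * s.
  rewrite -(@ler_pXn2r _ 2) ?nnegrE ?mulr_ge0 ?(ltW s0)// real_normK ?num_real//.
  apply: le_trans (cauchy_schwarz _ _) _.
  apply: le_trans (_ : n%:R * s ^+ 2 * (64 * n%:R)^-1 <= _).
    by apply: ler_pM; rewrite ?dotp_ge0.
  by rewrite le_eqVlt; apply/orP; left; apply/eqP; field; rewrite gt_eqF.
have yu : 55 / 100 * x * s <= dotp y u.
  have -> : dotp y u = dotp y (U f) + dotp y (u - U f).
    by rewrite dotpDr dotpNr addrC subrK.
  have := ler_wpM2r (ltW s0) xr; move: pert; rewrite ler_norml => /andP[p1 _].
  by rewrite mulrBl; lra.
have xs0 : 0 < 55 / 100 * x * s by rewrite !mulr_gt0//; lra.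
have yu0 : 0 < dotp y u by exact: lt_le_trans yu.
have yy0 : 0 < dotp y y.
  rewrite lt_neqAle dotp_ge0 andbT eq_sym; apply/eqP => /dotp_eq0 y0.
  by move: yu0; rewrite y0 dotp0l ltxx.
have vy : dotp v y = V * dotp y u.
  by rewrite dotpZr mulrA mulfV ?gt_eqF// mul1r dotpC.
have [||k hk] := @reduction_exists R n (dotp v v) (dotp v y) (dotp y y) n40 yy0.
- rewrite vy; apply: le_trans (_ : 55 / 100 * (n%:R * s ^+ 2) <= _); first by rewrite ler_pM2l.
  apply: le_trans (_ : d * (55 / 100 * x * s) <= _).
    rewrite (_ : d * _ = 55 / 100 * (d * x) * s); last by ring.
    by rewrite dx le_eqVlt; apply/orP; left; apply/eqP; ring.
  by apply: ler_pM => //; exact: ltW.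
(* Here [0.55^2 = 0.3025] exceeds 3/10 and [x >= 1]. *)
- rewrite vy exprMn V2 -[leRHS]mulrA (mulrCA (3 / 10)) ler_pM2l//.
  have : (55 / 100 * x * s) ^+ 2 <= dotp y u ^+ 2 by rewrite lerXn2r ?nnegrE// ltW.
  move=> /(ler_wpM2r (ltW n0)); apply: le_trans.
  apply: le_trans (_ : 3 / 10 * (n%:R * s ^+ 2) <= _); first by rewrite ler_pM2l.
  rewrite (_ : _ ^+ 2 * _ = 3025 / 10000 * (x ^+ 2 * (n%:R * s ^+ 2))); last by field.
  have : 1 * (n%:R * s ^+ 2) <= x ^+ 2 * (n%:R * s ^+ 2).
    by rewrite ler_wpM2r ?exprn_ege1// mulr_ge0 ?sqr_ge0// ltW.
  have : 0 <= n%:R * s ^+ 2 by rewrite mulr_ge0 ?sqr_ge0// ltW.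
  lra.
exists (v - k%:~R *: y), i, k; split=> //.
by rewrite !enorm_sqr dotp_sub_scale.
Qed.

(** All steps together contribute [expR (- 100 n)], which absorbs [(2^n)^2 <= expR (2 n)]. *)
Lemma shrink_run_bound (s t0 : R) : (1 <= n)%N -> 0 <= t0 -> t0 <= 2 ^+ n * s ->
  shrink n ^+ max_steps n * t0 ^+ 2 <= s ^+ 2.
Proof.
move=> n1 t00 t0s; have n0 : 0 < n%:R :> R by rewrite ltr0n.
apply: le_trans (_ : expR (- (100 * n%:R)) * (2 ^+ n * s) ^+ 2 <= _).
  apply: ler_pM; rewrite ?exprn_ge0 ?shrink_ge0//; last by rewrite lerXn2r ?nnegrE// (le_trans t00).
  apply: le_trans (_ : expR (- (n%:R ^+ 2)^-1) ^+ max_steps n <= _).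
    by rewrite lerXn2r ?nnegrE ?shrink_ge0 ?expR_ge0 ?expR_ge1Dx.
  rewrite -expRM_natr ler_expR /max_steps natrM natrX le_eqVlt; apply/orP; left; apply/eqP.
  by field; rewrite gt_eqF.
rewrite exprMn mulrA ler_piMl ?sqr_ge0//.
apply: le_trans (_ : expR (- (100 * n%:R)) * expR n%:R ^+ 2 <= _).
  by rewrite ler_pM2l ?expR_gt0// lerXn2r ?nnegrE ?exprn_ge0 ?expR_ge0// exp2_le_expR.
by rewrite -expRM_natr -expRD -[leRHS]expR0 ler_expR; lra.
Qed.

End Covering.

(** * The parameters as functions of [n] and [alpha] *)

Section TradeOff.
Context {R : realType}.

Lemma powR_expR (a x : R) : 0 < a -> a `^ x = expR (x * ln a).
Proof. by move=> a0; rewrite /powR gt_eqF. Qed.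

Lemma ln2_bounds : 1 / 2 <= (ln 2 : R) <= 1.
Proof.
apply/andP; split; rewrite -ler_expR lnK ?posrE//; last by apply: le_trans (expR_ge1Dx _); lra.
have h : expR (1 / 2) * expR (- (1 / 2)) = 1 :> R by rewrite -expRD subrr expR0.
have h1 : 1 - 1 / 2 <= expR (- (1 / 2)) :> R by exact: expR_ge1Dx.
have := ler_wpM2l (expR_ge0 (1 / 2 : R)) h1; rewrite h; lra.
Qed.

Variables (n : nat) (alpha : R).
Hypotheses (n40 : (40 <= n)%N) (alpha_bounds : 2 / log2 n%:R <= alpha <= 2^-1).

Let n_ge40 : 40 <= n%:R :> R. Proof. by rewrite ler_nat. Qed.
Let n_gt0 : 0 < n%:R :> R. Proof. by apply: lt_le_trans n_ge40. Qed.
Let ln2_gt0 : 0 < ln 2 :> R. Proof. by have /andP[h _] := ln2_bounds; lra. Qed.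

Lemma ln_n_ge : 5 * ln 2 <= ln n%:R :> R.
Proof.
rewrite (_ : 5 * ln 2 = ln (2 ^+ 5)); last by rewrite lnXn// mulr_natl.
by have h := n_ge40; rewrite ler_ln ?posrE//; lra.
Qed.

Let x := n%:R `^ (2^-1 - alpha) : R.

Lemma xE : x = expR ((2^-1 - alpha) * ln n%:R).
Proof. exact: powR_expR. Qed.

Lemma x_ge1 : 1 <= x.
Proof.
have /andP[_ a2] := alpha_bounds; have h := ln_n_ge; have l2 := ln2_gt0.
rewrite xE -[leLHS]expR0 ler_expR mulr_ge0//; lra.
Qed.

Lemma x_sqrE : x ^+ 2 = n%:R `^ (1 - 2 * alpha).
Proof. by rewrite xE powR_expR// -expRM_natr; congr expR; field. Qed.

(** The lower bound on [alpha] says [n^alpha >= 4], and [x^2 = n / (n^alpha)^2]. *)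
Lemma x_sqr_le : x ^+ 2 <= n%:R / 16.
Proof.
have /andP[a1 _] := alpha_bounds; have h := ln_n_ge; have l2 := ln2_gt0.
have ln0 : 0 < ln n%:R :> R by lra.
have al : 2 * ln 2 <= alpha * ln n%:R.
  by move: a1; rewrite /log2 invf_div mulrA ler_pdivrMr.
rewrite x_sqrE powR_expR//.
have -> : n%:R / 16 = expR (ln n%:R - 4 * ln 2) :> R.
  rewrite expRD lnK ?posrE//; congr (_ * _).
  by rewrite expRN expRM_natl lnK ?posrE//; congr (_^-1); ring.
by rewrite ler_expR; lra.
Qed.

Lemma distance_mul (s : R) : gdd_distance n alpha s * x = n%:R * s.
Proof.
rewrite /gdd_distance xE powR_expR// mulrAC -expRD -mulrDl.
by rewrite (_ : _ + _ = 1) ?mul1r ?lnK ?posrE//; field.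
Qed.

Lemma distance_ge (s : R) : 0 < s -> s <= gdd_distance n alpha s.
Proof.
move=> s0; rewrite ler_peMl ?(ltW s0)//.
have /andP[a1 _] := alpha_bounds; have h := ln_n_ge; have l2 := ln2_gt0.
have ln0 : 0 < ln n%:R :> R by lra.
rewrite powR_expR// -[leLHS]expR0 ler_expR mulr_ge0 ?(ltW ln0)//.
have : 0 <= 2 / log2 n%:R :> R by rewrite divr_ge0// divr_ge0// ltW.
lra.
Qed.

Lemma NalphaE : Nalpha n alpha = n%:R ^+ 2 * expR ((x + 4) ^+ 2).
Proof. by []. Qed.

Lemma Nalpha_ge1 : 1 <= Nalpha n alpha.
Proof.
rewrite NalphaE -[leLHS]mulr1 ler_pM//; first by have h := n_ge40; rewrite exprn_ege1//; lra.
by rewrite -[leLHS]expR0 ler_expR sqr_ge0.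
Qed.

Lemma Nalpha_upper :
  Nalpha n alpha <= 2 `^ (20 * (n%:R `^ (1 - 2 * alpha) + log2 n%:R)).
Proof.
have /andP[l1 _] := ln2_bounds; have h := ln_n_ge; have l2 := ln2_gt0.
rewrite NalphaE -x_sqrE powR_expR//.
have -> : n%:R ^+ 2 = expR (2 * ln n%:R) :> R by rewrite expRM_natl lnK ?posrE.
rewrite -expRD ler_expR.
have -> : 20 * (x ^+ 2 + log2 n%:R) * ln 2 = 20 * (x ^+ 2 * ln 2) + 20 * ln n%:R.
  by rewrite /log2; field; rewrite gt_eqF.
(* [(y + 4)^2 <= 2 y^2 + 32]: the square is paid for by [20 b >= 10], and 32 by [18 a >= 45]. *)
have aux (y a b : R) : 5 * b <= a -> 1 / 2 <= b -> y ^+ 2 * (1 / 2) <= y ^+ 2 * b ->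
    2 * a + (y + 4) ^+ 2 <= 20 * (y ^+ 2 * b) + 20 * a.
  by move=> ? ? ?; have := sqr_ge0 (y - 4); have := sqr_ge0 y; lra.
by apply: aux => //; rewrite ler_wpM2l ?sqr_ge0.
Qed.

Lemma nsamples_bounds : Nalpha n alpha <= (nsamples n alpha)%:R <= 2 * Nalpha n alpha.
Proof.
have N1 := Nalpha_ge1; have /andP[c1 c2] := ceil_itv (Nalpha n alpha).
have c0 : 0 <= Num.ceil (Nalpha n alpha).
  by rewrite -(ler_int R) (le_trans _ c2)//; lra.
rewrite /nsamples natr_absz ger0_norm// c2/=.
by rewrite intrB -[1%:~R]/(1 : R) in c1; lra.
Qed.

Lemma failure_bound (p : R) : p = 2 * expR (- (x + 4) ^+ 2) ->
  #|{ffun 'I_n -> 'I_(16 * n).+1}|%:R * expR (- (p * (nsamples n alpha)%:R)) <=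
  2 `^ (- (1 * n%:R)).
Proof.
move=> pE; have /andP[N1 _] := nsamples_bounds.
have /andP[_ l2] := ln2_bounds.
have pN : 2 * n%:R ^+ 2 <= p * (nsamples n alpha)%:R.
  have -> : 2 * n%:R ^+ 2 = p * Nalpha n alpha.
    have e : expR (- (x + 4) ^+ 2) * expR ((x + 4) ^+ 2) = 1 by rewrite -expRD addNr expR0.
    transitivity (2 * n%:R ^+ 2 * (expR (- (x + 4) ^+ 2) * expR ((x + 4) ^+ 2))).
      by rewrite e mulr1.
    by rewrite pE NalphaE; ring.
  by rewrite ler_wpM2l// pE mulr_ge0 ?expR_ge0.
rewrite card_ffun !card_ord natrX.
(* [16 n <= n^2 / 2] for [n >= 40], so the net has at most [expR (n^2)] points. *)
have c1 : ((16 * n).+1)%:R <= expR n%:R :> R.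
  apply: le_trans (expR_ge1Dxn 1 (ltW n_gt0)).
  rewrite -natr1 natrM addrC lerD2l ler_pdivlMr ?ltr0n//.
  rewrite (_ : (2`!)%:R = 2 :> R)// expr2; have := ler_wpM2r (ltW n_gt0) n_ge40.
  by have n0 := n_gt0; lra.
apply: le_trans (_ : expR n%:R ^+ n * expR (- (2 * n%:R ^+ 2)) <= _).
  apply: ler_pM; rewrite ?exprn_ge0 ?expR_ge0//.
    by rewrite lerXn2r ?nnegrE ?expR_ge0.
  by rewrite ler_expR lerN2.
rewrite -expRM_natr -expRD powR_expR// ler_expR.
have : n%:R * ln 2 <= n%:R * 1 :> R by rewrite ler_pM2l.
have := ler_wpM2r (ltW n_gt0) n_ge40; have n0 := n_gt0; lra.
Qed.

(** [10 n + 7 <= 17 n] gives [1700 n^4] per sample, rounding up at most doubles [Nalpha], and the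
    final subtraction adds 1: hence 3401. *)
Lemma query_cost_bound (Cb eb c r : nat) : (c <= Cb * n ^ eb)%N ->
  (r <= c + (100 * n ^ 3 * (nsamples n alpha * (10 * n + 7)) + n))%N ->
  r%:R <= ((Cb + 3401) * n ^ (eb + 4))%:R * Nalpha n alpha.
Proof.
move=> cC rc; have /andP[_ N2] := nsamples_bounds; have N1 := Nalpha_ge1.
set A := Nalpha n alpha in N1 N2 *; set N := nsamples n alpha in rc N2.
have n1 : (0 < n)%N by lia.
have h1 : (r <= Cb * n ^ (eb + 4) + (1700 * n ^ (eb + 4) * N + n ^ (eb + 4)))%N.
  apply: leq_trans rc _; apply: leq_add.
    by apply: leq_trans cC _; rewrite leq_mul2l leq_pexp2l ?orbT//; lia.
  apply: leq_add; last by rewrite -[X in (X <= _)%N]expn1 leq_pexp2l//; lia.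
  apply: leq_trans (_ : 1700 * n ^ 4 * N <= _)%N; last first.
    by rewrite leq_mul2r leq_mul2l leq_pexp2l ?orbT//; lia.
  have -> : (1700 * n ^ 4 * N = 100 * n ^ 3 * (N * (17 * n)))%N by rewrite (expnS n 3); nia.
  by rewrite leq_mul2l leq_mul2l; lia.
rewrite -(ler_nat R) in h1; apply: le_trans h1 _.
rewrite !natrD !natrM natrD.
set E : R := (n ^ (eb + 4))%:R; have E0 : 0 <= E by rewrite ler0n.
have h2 : E * N%:R <= E * (2 * A) by rewrite ler_wpM2l.
have h3 : E * 1 <= E * A by rewrite ler_wpM2l.
have h4 : Cb%:R * (E * 1) <= Cb%:R * (E * A) by rewrite ler_wpM2l.
lra.
Qed.

End TradeOff.

(** * From covered directions to success, and the final assembly *)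

Section SuccessEvent.
Context {R : realType}.
Variables (n : nat) (B : 'M[R]_n) (eta alpha : R).
Hypotheses (n40 : (40 <= n)%N) (alpha_bounds : 2 / log2 n%:R <= alpha <= 2^-1).
Hypotheses (freeB : row_free B) (smooth : is_smoothing_parameter (lattice_of B) eta).
Local Notation L := (lattice_of B).

(** The deterministic half: a stuck vector has norm at most [d] by [step_exists], and an exhausted
    run ends below [eta <= d]. The target enters only through its coset. *)
Lemma gdd_solution_covered N (Y : 'I_N -> 'rV[R]_n) (r : R)
    (I : Type) (U : I -> 'rV[R]_n) t0 t y :
  (forall i, L (Y i)) -> 55 / 100 * n%:R `^ (2^-1 - alpha) <= r - 1 / 8 ->
  (forall u, dotp u u = 1 -> exists f, dotp (u - U f) (u - U f) <= (64 * n%:R)^-1) ->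
  (forall f, exists i, good_point eta r (U f) (Y i)) ->
  L (t0 - t) -> enorm t0 <= 2 ^+ n * eta ->
  gdd_output Y t0 t y -> gdd_solution L (gdd_distance n alpha eta) t y.
Proof.
have [eta0 _] := smooth; have n1 : (1 <= n)%N by exact: leq_trans n40.
move=> LY xr net good L0 t0_le [u run ->].
have d0 := lt_le_trans eta0 (distance_ge n40 alpha_bounds eta0).
split.
  rewrite (_ : t - u = - (t0 - t) + (t0 - u)); last by rewrite opprB -addrA addKr.
  by apply: latticeD; [exact: latticeN|exact: (run_coset LY run)].
rewrite addrAC subrr add0r.
have -> : enorm (- u) = enorm u by rewrite /enorm dotpNl dotpNr opprK.
rewrite -(@ler_pXn2r _ 2) ?nnegrE ?sqrtr_ge0 ?(ltW d0)//.
have [stuck|le] := run_end n1 run.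
  rewrite leNgt; apply/negP; rewrite enorm_sqr => du.
  have [v' /stuck] // := step_exists n40 eta0 (x_ge1 n40 alpha_bounds) xr
    (distance_mul alpha n40 eta) net good (ltW d0) du.
apply: le_trans le _; apply: le_trans (shrink_run_bound n1 _ t0_le) _; first exact: sqrtr_ge0.
by rewrite lerXn2r ?nnegrE ?(ltW eta0) ?(ltW d0)// distance_ge.
Qed.

(** The normalisation of [dgauss] is the same [S] that scales [direction_lower_bound], so it
    cancels. *)
Lemma good_point_probability (u : 'rV[R]_n) (t : R) : dotp u u = 1 ->
  t + 1 = (n%:R `^ (2^-1 - alpha) + 4) / Num.sqrt pi ->
  (forall z, 0 <= dgauss L eta (lpoint B z)) /\
  2 * expR (- (n%:R `^ (2^-1 - alpha) + 4) ^+ 2) <=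
  rsum (fun z => dgauss L eta (lpoint B z) * (good_point eta (t - 1) u (lpoint B z))%:R).
Proof.
have [eta0 sm] := smooth; move=> u1 tE.
have x1 := x_ge1 n40 alpha_bounds; have [t0 _] := radius_bound x1 tE.
have [S S0 [rS gS]] := lattice_gauss_bounds freeB eta0 sm.
have sw : summ (fun z => rho eta (lpoint B z)).
  by have [s0 _ _] := gS 0; apply: eq_summ s0 => z; rewrite subr0.
have dE z : dgauss L eta (lpoint B z) = S^-1 * rho eta (lpoint B z).
  rewrite /dgauss /rho_set esum_lattice// -rsumE//=; last by move=> ?; exact: rho_ge0.
  by rewrite rS mulrC.
split=> [z|]; first by rewrite dE mulr_ge0 ?rho_ge0// invr_ge0 ltW.
have key := direction_lower_bound eta0 S0 (fun v => let: And3 a _ _ := gS v in a)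
  (fun v => let: And3 _ b _ := gS v in b) (fun v => let: And3 _ _ c := gS v in c) u1 t0.
under eq_rsum do rewrite dE -mulrA.
rewrite rsumZ; last first.
  apply: summ_le sw => z; rewrite normrM (ger0_norm (rho_ge0 _ _)) normr_nat.
  by case: good_point; rewrite ?mulr1 ?mulr0 ?rho_ge0.
rewrite [leRHS]mulrC ler_pdivlMr// [leLHS]mulrC; apply: le_trans key.
rewrite ler_pM2l//; apply: prob_bound => //.
exact: x_sqr_le.
Qed.

End SuccessEvent.

Theorem theorem3p1 (R : realType) :
  exists c K : R, 0 < c /\
  forall Cb eb : nat, exists C e : nat,
  forall (n : nat) (L : set 'rV[R]_n) (eta alpha : R)
    (babai : 'rV[R]_n -> timed 'rV[R]_n),
    (40 <= n)%N ->
    is_lattice L ->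
    is_smoothing_parameter L eta ->
    babai_spec L eta (Cb * n ^ eb)%N babai ->
    2 / log2 n%:R <= alpha <= 2^-1 ->
    Nalpha n alpha <= 2 `^ (K * (n%:R `^ (1 - 2 * alpha) + log2 n%:R)) /\
    forall (disp : measure_display) (T : measurableType disp)
      (P : probability T R) (Y : 'I_(nsamples n alpha) -> T -> 'rV[R]_n),
      iid_dgauss P Y L eta ->
      let success := [set omega | forall t y,
        gdd_output (Y ^~ omega) (babai t).1 t y ->
        gdd_solution L (gdd_distance n alpha eta) t y] in
      [/\ measurable success,
          (P success >= (1 - 2 `^ (- (c * n%:R)))%:E)%E &
          forall omega t,
            let r := gdd_query babai (Y ^~ omega) t in
            gdd_output (Y ^~ omega) (babai t).1 t r.1 /\
            r.2%:R <= (C * n ^ e)%:R * Nalpha n alpha].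
Proof.
exists 1, 20; split=> // Cb eb; exists (Cb + 3401)%N, (eb + 4)%N.
move=> n _ eta alpha babai n40 [B freeB ->] smooth babaiP alpha_bounds.
split; first exact: Nalpha_upper.
move=> disp T P Y iidY success; have [lawY _] := iidY.
have n0 : (0 < n)%N by lia.
have [U [U1 net]] := @unit_net R n n0.
pose x : R := n%:R `^ (2^-1 - alpha).
(* Makes [pi * (t + 1)^2] equal to the exponent [(x + 4)^2] of [Nalpha]. *)
pose t : R := (x + 4) / Num.sqrt pi - 1.
have tE : t + 1 = (x + 4) / Num.sqrt pi by rewrite /t subrK.
have [_ xr] := radius_bound (x_ge1 n40 alpha_bounds) tE.
(* [success] quantifies over uncountably many targets, but depends on [omega] only through the
   samples. *)
have msuccess : measurable success.
  exact: (measurable_samples (fun y => forall t u, gdd_output y (babai t).1 t u ->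
    gdd_solution (lattice_of B) (gdd_distance n alpha eta) t u) lawY).
split=> // [|omega v]; last first.
  split; first exact: query_correct.
  have [_ _ cost] := babaiP v.
  exact: (query_cost_bound n40 alpha_bounds cost (query_cost _ _ _)).
pose A f := good_point eta (t - 1) (U f).
have pA f := good_point_probability n40 alpha_bounds freeB smooth (U1 f) tE.
have d0 : forall z, 0 <= dgauss (lattice_of B) eta (lpoint B z).
  exact: (pA [ffun=> ord0]).1.
have p0 : 0 <= 2 * expR (- (x + 4) ^+ 2) :> R by rewrite mulr_ge0 ?expR_ge0.
have cover := covering_probability freeB (A := A) iidY p0 d0 (fun f => (pA f).2).
have sub : [set omega | forall f, exists i, A f (Y i omega)] `<=` success.
  move=> omega covered v y; have [L0 le0 _] := babaiP v.
  have LY i : lattice_of B (Y i omega) by exact: (lawY i).1.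
  exact: (@gdd_solution_covered _ _ _ _ _ n40 alpha_bounds smooth _ (Y ^~ omega) _ _ _
    _ _ y LY xr net covered L0 le0).
have mcover : measurable [set omega | forall f, exists i, A f (Y i omega)].
  exact: (measurable_samples (fun y => forall f, exists i, A f (y i)) lawY).
apply: le_trans (le_measure P _ _ sub); rewrite ?inE//.
apply: le_trans cover; rewrite lee_fin lerD2l lerN2.
exact: failure_bound.
Qed.
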